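(* The functors $\mathscr{B}\colon \mathsf{uHA}\to\mathsf{BA}$ and $\mathscr{H}\colon\mathsf{BA}\to\mathsf{uHA}$ form an equivalence of categories; that is, the composite functors $\mathscr{B}\mathscr{H}$ and $\mathscr{H}\mathscr{B}$ are naturally isomorphic to the identity functors on $\mathsf{BA}$ and on $\mathsf{uHA}$, respectively.
   Context: $\mathsf{BA}$ is the category of Boolean algebras and Boolean homomorphisms. A vector lattice is a lattice-ordered real vector space; $V^+=\{v\in V\mid v\ge 0\}$. A weak (order) unit of $V$ is an element $u\in V^+$ such that $u\wedge v=0$ implies $v=0$ for all $v\in V$. A unital vector lattice is a pair $(V,u)$ with $u$ a distinguished weak unit. A morphism $(V,u)\to(V',u')$ is a linear lattice homomorphism $f$ with $f(u)=u'$. A vector lattice is Archimedean if $0<v\le w$ implies $nv\not\le w$ for some positive integer $n$; it is hyperarchimedean if all of its homomorphic images are Archimedean. $\mathsf{uHA}$ is the category of unital vector lattices $(V,u)$ with $V$ hyperarchimedean, with all the morphisms just described. (In a hyperarchimedean vector lattice a weak unit $u$ is automatically a strong unit: every $v\in V^+$ satisfies $v\le nu$ for some positive integer $n$.) The functor $\mathscr{B}$: a Boolean element of $(V,u)$ is $v\in V$ such that there is $v'\in V$ with $v\wedge v'=0$ and $v\vee v'=u$; equivalently $0\le v\le u$ and $v\wedge(u-v)=0$. $\mathscr{B}(V)$ is the set of Boolean elements of $(V,u)$ with the lattice operations inherited from $V$; it is a Boolean algebra with least element $0$, greatest element $u$, and complement $v\mapsto u-v$. For a morphism $g\colon V\to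 W$, $\mathscr{B}(g)\colon\mathscr{B}(V)\to\mathscr{B}(W)$ is the restriction of $g$. The functor $\mathscr{H}$ (Specker group of a Boolean algebra): let $B$ be a Boolean algebra with greatest and least elements $\top,\bot$. Elements $b_1,b_2$ are disjoint if $b_1\wedge b_2=\bot$. A partition of $B$ is a maximal pairwise disjoint subset $P\subseteq B\smallsetminus\{\bot\}$. The common refinement of partitions $P_1,P_2$ is $P_1\wedge P_2=\{b_1\wedge b_2\mid b_i\in P_i,\ b_1\wedge b_2\ne\bot\}$. Let $Q$ be the set of all maps $v\colon P\to\mathbb{R}$ with $P$ a finite partition of $B$. For $v_i\colon P_i\to\mathbb{R}$ in $Q$ ($i=1,2$) and $\diamond\in\{+,\wedge,\vee\}$, define $v_1\diamond v_2\colon P_1\wedge P_2\to\mathbb{R}$ by $(v_1\diamond v_2)(b_1\wedge b_2)=v_1(b_1)\diamond v_2(b_2)$; scalar multiplication is defined pointwise, and the constant $0$ is the map $\{\top\}\to\mathbb{R}$ with value $0$ (when $B$ is trivial, the empty map). Identify two elements of $Q$ if they agree on the common refinement of their domains (i.e. $v_1(b_1)=v_2(b_2)$ whenever $b_1\wedge b_2\neq\bot$). The quotient $\mathscr{H}(B)$ is a vector lattice with strong unit $u$ the class of the map $\{\top\}\to\mathbb{R}$ with value $1$ (when $B$ is trivial, the class of the empty map), and is an object of $\mathsf{uHA}$. For a Boolean homomorphism $f\colon B\to A$ and a finite partition $P$ of $B$, $f(P)=\{f(b)\mid b\in P,\ f(b)\ne\bot\}$ is a finite partition of $A$, and $\mathscr{H}(f)$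 sends the class of $v\colon P\to\mathbb{R}$ to the class of the map $f(P)\to\mathbb{R}$, $f(b)\mapsto v(b)$. *)

(* Defs.v *)
From HB Require Import structures.
From mathcomp Require Import all_boot all_order all_algebra.
From mathcomp Require Import finmap.
From mathcomp Require Import boolp classical_sets reals.

Set Implicit Arguments.
Unset Strict Implicit.
Unset Printing Implicit Defensive.

Import Order.Theory GRing.Theory Num.Theory.
Local Open Scope quotient_scope.
Local Open Scope ring_scope.
Local Open Scope order_scope.

Record category := Category {
  obj :> Type;
  hom : obj -> obj -> Type;
  idm : forall X, hom X X;
  compm : forall X Y Z, hom Y Z -> hom X Y -> hom X Z;
  comp1m : forall X Y (f : hom X Y), compm (idm Y) f = f;
  compm1 : forall X Y (f : hom X Y), compm f (idm X) = f;
  compmA : forall X Y Z W (h : hom Z W) (g : hom Y Z) (f : hom X Y),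
    compm h (compm g f) = compm (compm h g) f }.
Arguments idm {c} X.
Arguments hom {c}.

Record functor (C D : category) := Functor {
  fobj :> C -> D;
  fhom : forall X Y : C, hom X Y -> hom (fobj X) (fobj Y);
  fhom1 : forall X : C, fhom (idm X) = idm (fobj X);
  fhomM : forall (X Y Z : C) (g : hom Y Z) (f : hom X Y),
    fhom (compm g f) = compm (fhom g) (fhom f) }.
Arguments fhom {C D} f {X Y} : rename.

Definition idF (C : category) : functor C C :=
  @Functor C C (fun X => X) (fun X Y f => f)
    (fun X => erefl) (fun X Y Z g f => erefl).

Section CompF.
Variables (C D E : category) (G : functor D E) (F : functor C D).
Let comp_fhom1 (X : C) : fhom G (fhom F (idm X)) = idm (G (F X)).
Proof. by rewrite !fhom1. Qed.
Let comp_fhomM (X Y Z : C) (g : hom Y Z) (f : hom X Y) :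
  fhom G (fhom F (compm g f))
  = compm (fhom G (fhom F g)) (fhom G (fhom F f)).
Proof. by rewrite !fhomM. Qed.
Definition compF : functor C E :=
  @Functor C E (fun X => G (F X)) (fun X Y f => fhom G (fhom F f))
    comp_fhom1 comp_fhomM.
End CompF.

Definition isomorphism (C : category) (X Y : C) (f : hom X Y) : Prop :=
  exists g : hom Y X, compm g f = idm X /\ compm f g = idm Y.

Definition naturally_isomorphic (C D : category) (F G : functor C D) : Prop :=
  exists alpha : forall X : C, hom (F X) (G X),
    (forall (X Y : C) (f : hom X Y),
       compm (alpha Y) (fhom F f) = compm (fhom G f) (alpha X))
    /\ (forall X : C, isomorphism (alpha X)).

(* All objects of BA share this display, which has no mathematical content. *)
Fact ba_display : Order.disp_t. Proof. exact: Order.Disp tt tt. Qed.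

(* {tblmorphism A -> B} only asks for the preservation of \bot and \top.
   Complements are preserved as well, see bool_compl. *)
Record boolHom d d' (A : ctbDistrLatticeType d) (B : ctbDistrLatticeType d') :=
  BoolHom {
    bool_fun :> A -> B;
    bool_meet : {morph bool_fun : x y / x `&` y};
    bool_join : {morph bool_fun : x y / x `|` y};
    bool_bot : bool_fun \bot = \bot;
    bool_top : bool_fun \top = \top }.

Lemma boolHom_eq d d' (A : ctbDistrLatticeType d) (B : ctbDistrLatticeType d')
  (f g : boolHom A B) : f =1 g -> f = g.
Proof.
case: f g => f f1 f2 f3 f4 [g g1 g2 g3 g4] /= /funext fg; subst g.
by congr BoolHom; apply: Prop_irrelevance.
Qed.

Lemma bool_compl d d' (A : ctbDistrLatticeType d) (B : ctbDistrLatticeType d')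
  (f : boolHom A B) : {morph f : x / ~` x}.
Proof.
move=> x; rewrite -[LHS]meet1x -(joinxC (f x)) meetUl -bool_meet meetxC.
rewrite bool_bot join0x -[RHS]meetx1 -(bool_top f) -(joinxC x) bool_join.
by rewrite meetUr [(~` _ `&` f x)%O]meetC meetxC join0x.
Qed.

Definition id_boolHom d (A : ctbDistrLatticeType d) : boolHom A A :=
  @BoolHom _ _ A A id (fun _ _ => erefl) (fun _ _ => erefl) erefl erefl.

Section CompBool.
Context d1 d2 d3 (A : ctbDistrLatticeType d1) (B : ctbDistrLatticeType d2)
  (C : ctbDistrLatticeType d3) (g : boolHom B C) (f : boolHom A B).
Let cI : {morph g \o f : x y / x `&` y}.
Proof. by move=> x y; rewrite /= !bool_meet. Qed.
Let cU : {morph g \o f : x y / x `|` y}.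
Proof. by move=> x y; rewrite /= !bool_join. Qed.
Let c0 : (g \o f) \bot = \bot.
Proof. by rewrite /= !bool_bot. Qed.
Let c1 : (g \o f) \top = \top.
Proof. by rewrite /= !bool_top. Qed.
Definition comp_boolHom : boolHom A C := @BoolHom _ _ A C (g \o f) cI cU c0 c1.
End CompBool.

Definition BA : category.
Proof.
refine (@Category (ctbDistrLatticeType ba_display) (fun A B => boolHom A B)
  (fun A => id_boolHom A) (fun A B C g f => comp_boolHom g f) _ _ _).
- by move=> *; apply: boolHom_eq.
- by move=> *; apply: boolHom_eq.
- by move=> *; apply: boolHom_eq.
Defined.

HB.mixin Record Lmodule_isVectorLattice (R : realType) V
    of GRing.Lmodule R V := {
  vl_le : rel V;
  vl_meet : V -> V -> V;
  vl_join : V -> V -> V;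
  vl_le_refl : reflexive vl_le;
  vl_le_anti : antisymmetric vl_le;
  vl_le_trans : transitive vl_le;
  vl_lexI : forall x y z, vl_le x (vl_meet y z) = vl_le x y && vl_le x z;
  vl_leUx : forall x y z, vl_le (vl_join x y) z = vl_le x z && vl_le y z;
  vl_le_add2l : forall z x y, vl_le x y -> vl_le (z + x) (z + y);
  vl_le_scale : forall (a : R) x, 0 <= a -> vl_le 0 x -> vl_le 0 (a *: x) }.

#[short(type="vectLatticeType")]
HB.structure Definition VectorLattice (R : realType) :=
  { V of GRing.Lmodule R V & Lmodule_isVectorLattice R V }.

(* The order instances are derived from the mixin above rather than required
   by the structure: a structure on top of both GRing.Zmodule and
   Order.Lattice ring_display is rejected, as Num.RealDomain would then no
   longer be the join of these two. *)
HB.instance Definition _ (R : realType) (V : vectLatticeType R) :=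
  Order.Le_isPOrder.Build ring_display (VectorLattice.sort V)
    (@vl_le_refl R V) (@vl_le_anti R V) (@vl_le_trans R V).
HB.instance Definition _ (R : realType) (V : vectLatticeType R) :=
  Order.POrder_MeetJoin_isLattice.Build ring_display (VectorLattice.sort V)
    (@vl_lexI R V) (@vl_leUx R V).

Section VectorLatticeTheory.
Context {R : realType} {V : vectLatticeType R}.
Implicit Types x y z : V.

Lemma vl_leD2l z x y : (z + x <= z + y) = (x <= y).
Proof.
apply/idP/idP; last exact: vl_le_add2l.
by move/(vl_le_add2l (- z)); rewrite !addKr.
Qed.

Lemma vl_leD2r z x y : (x + z <= y + z) = (x <= y).
Proof. by rewrite ![_ + z]addrC vl_leD2l. Qed.

Lemma vl_subr_ge0 x y : (0 <= y - x) = (x <= y).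
Proof. by rewrite -[LHS](vl_leD2r x) add0r subrK. Qed.

Lemma vl_leN2 x y : (- x <= - y) = (y <= x).
Proof. by rewrite -[LHS]vl_subr_ge0 opprK addrC vl_subr_ge0. Qed.

Lemma vl_leD x y z t : x <= y -> z <= t -> x + z <= y + t.
Proof.
move=> xy zt; apply: (@le_trans _ _ (y + z)); first by rewrite vl_leD2r.
by rewrite vl_leD2l.
Qed.

Lemma vl_scale_ge0 (a : R) x : 0 <= a -> 0 <= x -> 0 <= a *: x.
Proof. exact: vl_le_scale. Qed.

Lemma vl_addI z x y : z + (x `&` y) = (z + x) `&` (z + y).
Proof.
apply/le_anti/andP; split; first by rewrite lexI !vl_leD2l leIl leIr.
rewrite -(vl_leD2l (- z)) addKr lexI -(vl_leD2l z _ x) -(vl_leD2l z _ y).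
by rewrite !addNKr leIl leIr.
Qed.

Lemma vl_addU z x y : z + (x `|` y) = (z + x) `|` (z + y).
Proof.
apply/le_anti/andP; split; last first.
  by rewrite leUx ![z + _ <= _]vl_leD2l leUl leUr.
rewrite -(vl_leD2l (- z)) addKr leUx -(vl_leD2l z x) -(vl_leD2l z y).
by rewrite !addNKr leUl leUr.
Qed.

Lemma vl_oppI x y : - (x `&` y) = - x `|` - y.
Proof.
apply/le_anti/andP; split; last by rewrite leUx !vl_leN2 leIl leIr.
by rewrite -vl_leN2 opprK lexI -(vl_leN2 x) -(vl_leN2 y) !opprK leUl leUr.
Qed.

Lemma vl_oppU x y : - (x `|` y) = - x `&` - y.
Proof. by rewrite -[RHS]opprK vl_oppI !opprK. Qed.

Lemma vl_meetDjoin x y : (x `&` y) + (x `|` y) = x + y.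
Proof.
have: x + y - (x `&` y) = x `|` y.
  by rewrite vl_oppI vl_addU addrK addrAC subrr add0r joinC.
by move=> <-; rewrite addrC subrK.
Qed.

Lemma vl_meetUl x y z : (x `|` y) `&` z = (x `&` z) `|` (y `&` z).
Proof.
apply/le_anti/andP; split; last first.
  rewrite leUx !lexI !leIr !andbT.
  by rewrite (le_trans (leIl _ _) (leUl _ _)) (le_trans (leIl _ _) (leUr _ _)).
set s := x `|` y; set t := _ `|` _.
have aux w : w <= s -> w + (s `&` z) <= s + (w `&` z).
  move=> ws; rewrite [s + _]vl_addI lexI; apply/andP; split.
    by rewrite addrC vl_leD // leIl.
  by rewrite vl_leD // leIr.
rewrite -(vl_leD2l s) {1}/s addrC vl_addU leUx; apply/andP; split.
  rewrite addrC (le_trans (aux x _)) ?leUl // vl_leD2l leUl //.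
by rewrite addrC (le_trans (aux y _)) ?leUr // vl_leD2l leUr.
Qed.

End VectorLatticeTheory.

HB.instance Definition _ (R : realType) (V : vectLatticeType R) :=
  Order.Lattice_Meet_isDistrLattice.Build ring_display (VectorLattice.sort V)
    (@vl_meetUl R V).

Section UnitalVectorLattices.
Context (R : realType).

Definition weak_unit (V : vectLatticeType R) (u : V) : Prop :=
  0 <= u /\ forall v : V, u `&` v = 0 -> v = 0.

Definition archimedean (V : vectLatticeType R) : Prop :=
  forall v w : V, 0 < v -> v <= w -> exists n, (0 < n)%N /\ ~ v *+ n <= w.

Definition linear_lattice_hom (V W : vectLatticeType R) (f : V -> W) : Prop :=
  [/\ linear f, {morph f : x y / x `&` y} & {morph f : x y / x `|` y}].

Definition hyperarchimedean (V : vectLatticeType R) : Prop :=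
  forall (W : vectLatticeType R) (f : V -> W),
    linear_lattice_hom f -> (forall w, exists v, f v = w) -> archimedean W.

Record uHA_obj := UHA {
  uha_sort :> vectLatticeType R;
  uha_unit : uha_sort;
  uha_weak_unit : weak_unit uha_unit;
  uha_hyperarchimedean : hyperarchimedean uha_sort }.

Record uHA_hom (V W : uHA_obj) := UHAHom {
  uha_fun :> V -> W;
  uha_linear_lattice_hom : linear_lattice_hom uha_fun;
  uha_fun_unit : uha_fun (uha_unit V) = uha_unit W }.

Lemma uHA_hom_eq (V W : uHA_obj) (f g : uHA_hom V W) : f =1 g -> f = g.
Proof.
case: f g => f f1 f2 [g g1 g2] /= /funext fg; subst g.
by congr UHAHom; apply: Prop_irrelevance.
Qed.

Lemma id_linear_lattice_hom (V : vectLatticeType R) :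
  linear_lattice_hom (@id V).
Proof. by []. Qed.

Lemma comp_linear_lattice_hom (V W X : vectLatticeType R)
  (g : W -> X) (f : V -> W) :
  linear_lattice_hom g -> linear_lattice_hom f -> linear_lattice_hom (g \o f).
Proof.
move=> [gl gI gU] [fl fI fU]; split=> [a x y|x y|x y] /=.
- by rewrite fl gl.
- by rewrite fI gI.
- by rewrite fU gU.
Qed.

Definition id_uHA (V : uHA_obj) : uHA_hom V V :=
  @UHAHom V V id (id_linear_lattice_hom V) erefl.

Definition comp_uHA (V W X : uHA_obj) (g : uHA_hom W X) (f : uHA_hom V W) :
  uHA_hom V X :=
  @UHAHom V X (g \o f)
    (comp_linear_lattice_hom (uha_linear_lattice_hom g)
       (uha_linear_lattice_hom f))
    (etrans (congr1 g (uha_fun_unit f)) (uha_fun_unit g)).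

Definition uHA : category.
Proof.
refine (@Category uHA_obj uHA_hom id_uHA comp_uHA _ _ _).
- by move=> *; apply: uHA_hom_eq.
- by move=> *; apply: uHA_hom_eq.
- by move=> *; apply: uHA_hom_eq.
Defined.

End UnitalVectorLattices.

Section BooleanElements.
Context {R : realType} (V : uHA_obj R).
Local Notation u := (uha_unit V).

Definition boolean_element (v : V) : Prop :=
  exists v' : V, v `&` v' = 0 /\ v `|` v' = u.

Definition booleanElt : Type := {v : V | `[< boolean_element v >]}.
HB.instance Definition _ := [isSub of booleanElt for @sval _ _].
HB.instance Definition _ := [Choice of booleanElt by <:].
Implicit Types v w : V.

Let u_ge0 : 0 <= u. Proof. by case: (uha_weak_unit V). Qed.

Lemma boolean_elementC v v' :
  v `&` v' = 0 -> v `|` v' = u -> v' = u - v.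
Proof.
move=> I U; have := vl_meetDjoin v v'.
by rewrite I U add0r => ->; rewrite addrC addKr.
Qed.

Lemma boolean_elementE v :
  boolean_element v <-> v `&` (u - v) = 0 /\ v `|` (u - v) = u.
Proof.
split=> [[v' [I U]]|[I U]]; last by exists (u - v).
by rewrite -(boolean_elementC I U).
Qed.

Lemma boolean_elementP v :
  boolean_element v <-> [/\ 0 <= v, v <= u & v `&` (u - v) = 0].
Proof.
rewrite boolean_elementE; split=> [[I U]|[v0 vu I]].
  by split=> //; [rewrite -I leIl | rewrite -[in X in _ <= X]U leUl].
split=> //; have := vl_meetDjoin v (u - v).
by rewrite I add0r subrKC.
Qed.

Lemma boolean_elementI v w :
  boolean_element v -> boolean_element w -> boolean_element (v `&` w).
Proof.
move=> [v' [vI vU]] [w' [wI wU]]; exists (v' `|` w').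
have v'u : v' <= u by rewrite -vU leUr.
have w'u : w' <= u by rewrite -wU leUr.
have v0 : 0 <= v by rewrite -vI leIl.
have w0 : 0 <= w by rewrite -wI leIl.
split; first by rewrite meetUr meetAC vI -meetA wI (meet_l w0) (meet_r v0) joinxx.
rewrite joinIl joinA vU joinCA wU.
by rewrite (join_l w'u) (join_r v'u) meetxx.
Qed.

Lemma boolean_elementN v : boolean_element v -> boolean_element (u - v).
Proof.
move=> /boolean_elementE[I U]; exists v.
by rewrite meetC joinC.
Qed.

Lemma boolean_elementU v w :
  boolean_element v -> boolean_element w -> boolean_element (v `|` w).
Proof.
move=> bv bw.
have := boolean_elementN
  (boolean_elementI (boolean_elementN bv) (boolean_elementN bw)).
by rewrite -vl_addI -vl_oppU opprD opprK addrA subrr add0r.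
Qed.

Lemma boolean_element0 : boolean_element 0.
Proof. by exists u; rewrite (meet_l u_ge0) (join_r u_ge0). Qed.

Lemma boolean_element1 : boolean_element u.
Proof. by exists 0; rewrite (meet_r u_ge0) (join_l u_ge0). Qed.

Implicit Types a b c : booleanElt.

Definition mkBool (v : V) (bv : boolean_element v) : booleanElt :=
  exist _ v (asboolT bv).

Lemma booleanEltP a : boolean_element (val a).
Proof. exact: asboolW (valP a). Qed.

Definition belt_meet a b : booleanElt :=
  mkBool (boolean_elementI (booleanEltP a) (booleanEltP b)).
Definition belt_join a b : booleanElt :=
  mkBool (boolean_elementU (booleanEltP a) (booleanEltP b)).
Definition belt_bot : booleanElt := mkBool boolean_element0.
Definition belt_top : booleanElt := mkBool boolean_element1.
Definition belt_compl a : booleanElt :=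
  mkBool (boolean_elementN (booleanEltP a)).

Let b_le_def a b : (val a <= val b) = (belt_meet a b == a).
Proof. by rewrite leEmeet -val_eqE. Qed.
Let b_lt_def a b : (val a < val b) = (b != a) && (val a <= val b).
Proof. by rewrite lt_def val_eqE. Qed.
Let b_meetC : commutative belt_meet.
Proof. by move=> a b; apply: val_inj; rewrite /= meetC. Qed.
Let b_joinC : commutative belt_join.
Proof. by move=> a b; apply: val_inj; rewrite /= joinC. Qed.
Let b_meetA : associative belt_meet.
Proof. by move=> a b c; apply: val_inj; rewrite /= meetA. Qed.
Let b_joinA : associative belt_join.
Proof. by move=> a b c; apply: val_inj; rewrite /= joinA. Qed.
Let b_joinKI b a : belt_meet a (belt_join a b) = a.
Proof. by apply: val_inj; rewrite /= joinKI. Qed.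
Let b_meetKU b a : belt_join a (belt_meet a b) = a.
Proof. by apply: val_inj; rewrite /= meetKU. Qed.
Let b_meetUl : left_distributive belt_meet belt_join.
Proof. by move=> a b c; apply: val_inj; rewrite /= meetUl. Qed.
Let b_meetxx : idempotent_op belt_meet.
Proof. by move=> a; apply: val_inj; rewrite /= meetxx. Qed.

HB.instance Definition _ := @Order.isMeetJoinDistrLattice.Build ba_display
  booleanElt _ _ belt_meet belt_join b_le_def b_lt_def
  b_meetC b_joinC b_meetA b_joinA b_joinKI b_meetKU b_meetUl b_meetxx.

Let b_bot_le a : belt_bot <= a.
Proof. by case/boolean_elementP: (booleanEltP a). Qed.
Let b_le_top a : a <= belt_top.
Proof. by case/boolean_elementP: (booleanEltP a). Qed.
HB.instance Definition _ :=
  @Order.hasBottom.Build ba_display booleanElt belt_bot b_bot_le.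
HB.instance Definition _ :=
  @Order.hasTop.Build ba_display booleanElt belt_top b_le_top.

Let b_joinxC a : a `|` belt_compl a = \top.
Proof.
by apply: val_inj; case/boolean_elementE: (booleanEltP a).
Qed.
Let b_meetxC a : a `&` belt_compl a = \bot.
Proof.
by apply: val_inj; case/boolean_elementE: (booleanEltP a).
Qed.
HB.instance Definition _ := @Order.TBDistrLattice_hasComplement.Build
  ba_display booleanElt belt_compl b_joinxC b_meetxC.

Lemma belt_meetE a b : val (a `&` b) = val a `&` val b. Proof. by []. Qed.
Lemma belt_joinE a b : val (a `|` b) = val a `|` val b. Proof. by []. Qed.
Lemma belt_botE : val (\bot : booleanElt) = 0. Proof. by []. Qed.
Lemma belt_topE : val (\top : booleanElt) = u. Proof. by []. Qed.
Lemma belt_complE a : val (~` a) = u - val a. Proof. by []. Qed.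

End BooleanElements.

Section BooleanFunctor.
Context (R : realType).

Section OnMorphisms.
Context (V W : uHA_obj R) (g : uHA_hom V W).

Lemma uHA_hom0 : g 0 = 0.
Proof.
have [/(_ (- 1) 0 0)] := uha_linear_lattice_hom g.
by rewrite scaler0 addr0 scaleN1r addNr.
Qed.

Lemma boolean_element_hom v : boolean_element v -> boolean_element (g v).
Proof.
move=> [v' [I U]]; exists (g v').
have [_ gI gU] := uha_linear_lattice_hom g.
by rewrite -gI -gU I U uHA_hom0 uha_fun_unit.
Qed.

Definition belt_map (a : booleanElt V) : booleanElt W :=
  mkBool (boolean_element_hom (booleanEltP a)).

Let map_meet : {morph belt_map : a b / a `&` b}.
Proof.
by move=> a b; apply: val_inj; case: (uha_linear_lattice_hom g) => /= _ ->.
Qed.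
Let map_join : {morph belt_map : a b / a `|` b}.
Proof.
by move=> a b; apply: val_inj; case: (uha_linear_lattice_hom g) => /= _ _ ->.
Qed.
Let map_bot : belt_map \bot = \bot.
Proof. by apply: val_inj; rewrite /= uHA_hom0. Qed.
Let map_top : belt_map \top = \top.
Proof. by apply: val_inj; rewrite /= uha_fun_unit. Qed.

Definition Bfun_hom : boolHom (booleanElt V) (booleanElt W) :=
  BoolHom map_meet map_join map_bot map_top.

End OnMorphisms.

Definition Bfun : functor (uHA R) BA.
Proof.
refine (@Functor (uHA R) BA (fun V => booleanElt V : ctbDistrLatticeType _)
  (fun V W g => Bfun_hom g) _ _).
- by move=> V; apply: boolHom_eq => a; apply: val_inj.
- by move=> V W X g f; apply: boolHom_eq => a; apply: val_inj.
Defined.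

End BooleanFunctor.

Section Partitions.
Context d (B : ctbDistrLatticeType d).
Implicit Types (P : set B) (b c : B).

Definition disjoint_family P : Prop :=
  ~ P \bot /\ forall b c, P b -> P c -> b <> c -> b `&` c = \bot.

Definition is_partition P : Prop :=
  disjoint_family P /\
  forall P', disjoint_family P' -> (P `<=` P')%classic -> P' = P.

Lemma is_partitionP P : is_partition P <->
  disjoint_family P /\
  forall c, c != \bot -> exists2 b, P b & c `&` b != \bot.
Proof.
split=> [[Pd Pmax]|[Pd Pcov]].
  split=> // c c0; apply: contrapT => Pc.
  have cP b : P b -> c `&` b = \bot.
    by move=> Pb; apply/eqP; apply: contrapT => /negP cb; apply: Pc; exists b.
  have P'd : disjoint_family (c |` P)%classic.
    case: Pd => P0 Pd; split=> [[/= e|//]|b b' [->|Pb] [->|Pb'] bb'//].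
    - by rewrite -e eqxx in c0.
    - exact: cP.
    - by rewrite meetC; exact: cP.
    - exact: Pd.
  have Pcc : P c.
    by rewrite -(Pmax _ P'd); [left | move=> x Px; right].
  by move: (cP _ Pcc) c0; rewrite meetxx => ->; rewrite eqxx.
split=> // P' [P'0 P'd] PP'; apply/seteqP; split=> // x P'x.
have x0 : x != \bot by apply/eqP => x0; apply: P'0; rewrite -x0.
have [b Pb xb] := Pcov _ x0.
suff -> : x = b by [].
apply: contrapT => /(P'd _ _ P'x (PP' _ Pb)) xb0.
by rewrite xb0 eqxx in xb.
Qed.

End Partitions.

Section PreSpecker.
Context (R : realType) {d : Order.disp_t} (B : ctbDistrLatticeType d).
Implicit Types (P : {fset B}) (b c : B).

(* The set Q of all maps from a finite partition to R: v : {fmap B -> R} is a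
   function from the finite set domf v, of type {fset B}, to R. *)
Definition preSpecker : Type :=
  {v : {fmap B -> R} | `[< is_partition [set` domf v] >]}.
HB.instance Definition _ := [isSub of preSpecker for @sval _ _].
HB.instance Definition _ := [Choice of preSpecker by <:].
Implicit Types v w : preSpecker.

Definition pdom v : {fset B} := domf (val v).
Definition pfun v : pdom v -> R := ffun_of_fmap (val v).

Definition mkPre (v : {fmap B -> R}) (hv : is_partition [set` domf v]) :
  preSpecker := exist _ v (asboolT hv).

Lemma pdomP v : is_partition [set` pdom v].
Proof. exact: asboolW (valP v). Qed.

Lemma pdom_neq0 v b : b \in pdom v -> b != \bot.
Proof.
by have [[v0 _] _] := pdomP v => bv; apply/eqP => b0; apply: v0; rewrite /= -b0.
Qed.

Lemma pdom_eq v b b' c : b \in pdom v -> b' \in pdom v ->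
  c != \bot -> c <= b -> c <= b' -> b = b'.
Proof.
have [[_ vd] _] := pdomP v => bv b'v c0 cb cb'; apply: contrapT => bb'.
have bb0 := vd _ _ bv b'v bb'.
have : c <= b `&` b' by rewrite lexI cb.
by rewrite bb0 lex0 (negPf c0).
Qed.

Lemma pdom_cover v c : c != \bot -> exists2 b, b \in pdom v & c `&` b != \bot.
Proof. by have /is_partitionP[_] := pdomP v; apply. Qed.

Definition refinement P1 P2 : {fset B} :=
  [fset c in [fset (p.1 `&` p.2)%O | p in P1 `*` P2] | c != \bot%O]%fset.

Lemma refinementP P1 P2 c :
  reflect (c != \bot /\
           exists b1 b2, [/\ b1 \in P1, b2 \in P2 & c = b1 `&` b2])
          (c \in refinement P1 P2).
Proof.
rewrite !inE /=; apply: (iffP andP) => [[/imfsetP[[b1 b2] /=]]|].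
  by rewrite inE => /andP[b1P b2P] -> c0; split=> //; exists b1, b2.
move=> [c0 [b1 [b2 [b1P b2P cE]]]]; split=> //; apply/imfsetP.
by exists (b1, b2); rewrite //= inE b1P.
Qed.

Lemma refinement_partition v w :
  is_partition [set` refinement (pdom v) (pdom w)].
Proof.
apply/is_partitionP; split.
  split=> [/= /refinementP[]|b c /= /refinementP[b0 [b1 [b2 [b1v b2w bE]]]]].
    by rewrite eqxx.
  move=> /refinementP[c0 [c1 [c2 [c1v c2w cE]]]] bc.
  apply/eqP; apply: contrapT => /negP bc0; apply: bc.
  have le1 : b `&` c <= b1 by apply: (le_trans (leIl _ _)); rewrite bE leIl.
  have le2 : b `&` c <= b2 by apply: (le_trans (leIl _ _)); rewrite bE leIr.
  have le3 : b `&` c <= c1 by apply: (le_trans (leIr _ _)); rewrite cE leIl.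
  have le4 : b `&` c <= c2 by apply: (le_trans (leIr _ _)); rewrite cE leIr.
  by rewrite bE cE (pdom_eq b1v c1v bc0 le1 le3) (pdom_eq b2w c2w bc0 le2 le4).
move=> c c0; have [b1 b1v cb1] := pdom_cover v c0.
have [b2 b2w cb] := pdom_cover w cb1; exists (b1 `&` b2); last by rewrite meetA.
apply/refinementP; split; last by exists b1, b2.
by apply: contraNneq cb => b0; rewrite -meetA b0 meetx0.
Qed.

(* value of v at the unique block of its domain above c, when there is one *)
Definition pval v c : R :=
  if [pick b : pdom v | c <= val b] is Some b then pfun b else 0.

Definition pdef v c : bool := [exists b : pdom v, c <= val b].

Lemma pvalE v c (b : pdom v) : c != \bot -> c <= val b -> pval v c = pfun b.
Proof.
move=> c0 cb; rewrite /pval; case: pickP => [b' cb'|/(_ b)]; last by rewrite cb.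
by congr pfun; apply: val_inj; apply: (pdom_eq _ _ c0 cb' cb); exact: fsvalP.
Qed.

Lemma pdefP v c : c != \bot -> pdef v c ->
  exists b : pdom v, c <= val b /\ pval v c = pfun b.
Proof. by move=> c0 /existsP[b cb]; exists b; rewrite (pvalE c0 cb). Qed.

Lemma pdefS v c c' : c' <= c -> pdef v c -> pdef v c'.
Proof.
by move=> cc' /existsP[b cb]; apply/existsP; exists b; apply: le_trans cb.
Qed.

Lemma pvalS v c c' : c' != \bot -> c' <= c -> pdef v c -> pval v c' = pval v c.
Proof.
move=> c'0 cc' /pdefP[|b [cb ->]].
  by apply: contraNneq c'0 => c0; rewrite -lex0 -c0.
by apply: pvalE => //; apply: le_trans cb.
Qed.

(* op (v b1) (w b2) at b1 `&` b2, see pre_opE *)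
Definition pre_op (op : R -> R -> R) v w : preSpecker :=
  @mkPre [fmap c : refinement (pdom v) (pdom w) =>
            op (pval v (val c)) (pval w (val c))]
         (refinement_partition v w).

Lemma pre_opE op v w (b1 : pdom v) (b2 : pdom w) (c : pdom (pre_op op v w)) :
  val c = val b1 `&` val b2 -> pfun c = op (pfun b1) (pfun b2).
Proof.
move=> cE; have c0 := pdom_neq0 (fsvalP c).
rewrite -(@pvalE v (val c)) ?cE ?leIl -?cE// -(@pvalE w (val c)) ?cE ?leIr -?cE//.
by rewrite /pfun ffunE.
Qed.

Lemma pdef_op op v w c : c != \bot ->
  pdef v c -> pdef w c -> pdef (pre_op op v w) c.
Proof.
move=> c0 /existsP[b1 cb1] /existsP[b2 cb2].
have cb : c <= val b1 `&` val b2 by rewrite lexI cb1.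
have bP : val b1 `&` val b2 \in pdom (pre_op op v w).
  apply/refinementP; split; last by exists (val b1), (val b2); split=> //; exact: fsvalP.
  by apply: contraNneq c0 => b0; rewrite -lex0 -b0.
by apply/existsP; exists [` bP]%fset.
Qed.

Lemma pval_op op v w c : c != \bot -> pdef v c -> pdef w c ->
  pval (pre_op op v w) c = op (pval v c) (pval w c).
Proof.
move=> c0 cv cw; have [b [cb ->]] := pdefP c0 (pdef_op op c0 cv cw).
have b0 := pdom_neq0 (fsvalP b).
rewrite /pfun ffunE; have /refinementP[_ [b1 [b2 [b1v b2w bE]]]] := fsvalP b.
have bv : pdef v (val b) by apply/existsP; exists [` b1v]%fset; rewrite /= bE leIl.
have bw : pdef w (val b) by apply/existsP; exists [` b2w]%fset; rewrite /= bE leIr.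
by rewrite -(pvalS c0 cb bv) -(pvalS c0 cb bw).
Qed.

Definition pre_scale (a : R) v : preSpecker :=
  @mkPre [fmap b : pdom v => a * pfun b] (pdomP v).

Lemma pdef_scale a v c : pdef (pre_scale a v) c = pdef v c.
Proof. by []. Qed.

Lemma pval_scale a v c : c != \bot -> pdef v c ->
  pval (pre_scale a v) c = a * pval v c.
Proof.
move=> c0 cv; have [b [cb ->]] := pdefP c0 cv.
have := @pvalE (pre_scale a v) c b c0 cb.
by rewrite [pfun _]ffunE.
Qed.

Definition const_fmap (r : R) : {fmap B -> R} :=
  if \top == \bot :> B then [fmap]%fmap else [fmap].[(\top : B)%O <- r]%fmap.

Lemma const_partition r : is_partition [set` domf (const_fmap r)].
Proof.
apply/is_partitionP; rewrite /const_fmap; case: (eqVneq \top) => [b01|b10].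
  split=> // c; suff -> : c = \bot by rewrite eqxx.
  by rewrite -[LHS]meetx1 b01 meetx0.
split=> [|c c0]; last by exists \top; rewrite /= ?meetx1// !inE eqxx.
split=> [/=|b c /=]; first by rewrite !inE orbF eq_sym (negPf b10).
by rewrite !inE !orbF => /eqP-> /eqP->.
Qed.

Definition pre_const r : preSpecker := mkPre (const_partition r).

Lemma pfun_const r (b : pdom (pre_const r)) : pfun b = r.
Proof.
have : (val (pre_const r)).[? val b]%fmap = Some (pfun b).
  by rewrite -Some_fnd.
rewrite /= /const_fmap; case: eqP => [_|_]; first by rewrite fnd_fmap0.
by rewrite fnd_set; case: eqP => [_ [<-]|_] //; rewrite fnd_fmap0.
Qed.

Lemma pval_const r c : c != \bot -> pdef (pre_const r) c ->
  pval (pre_const r) c = r.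
Proof. by move=> c0 /(pdefP c0)[b [_ ->]]; rewrite pfun_const. Qed.

(* v and w agree on the common refinement of their domains *)
Definition pre_eq v w : bool :=
  [forall b1 : pdom v, forall b2 : pdom w,
     (val b1 `&` val b2 != \bot) ==> (pfun b1 == pfun b2)].

Lemma pre_eqP v w :
  reflect (forall c, c != \bot -> pdef v c -> pdef w c -> pval v c = pval w c)
          (pre_eq v w).
Proof.
apply: (iffP 'forall_'forall_implyP) => [vw c c0|vw b1 b2 b0].
  move=> /(pdefP c0)[b1 [cb1 ->]] /(pdefP c0)[b2 [cb2 ->]].
  apply/eqP/vw; apply: contraNneq c0 => b0; rewrite -lex0 -b0 lexI cb1.
  exact: cb2.
apply/eqP; rewrite -(@pvalE v _ b1 b0) ?leIl// -(@pvalE w _ b2 b0) ?leIr//.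
by apply: vw => //; apply/existsP; [exists b1; rewrite leIl | exists b2; rewrite leIr].
Qed.

Lemma pdef_dense v c : c != \bot -> exists c', [/\ c' != \bot, c' <= c & pdef v c'].
Proof.
move=> /(pdom_cover v)[b bv cb]; exists (c `&` b); split=> //; first exact: leIl.
by apply/existsP; exists [` bv]%fset; rewrite leIr.
Qed.

Lemma pre_eq_refl : reflexive pre_eq.
Proof. by move=> v; apply/pre_eqP. Qed.

Lemma pre_eq_sym : symmetric pre_eq.
Proof.
have s v w : pre_eq v w -> pre_eq w v.
  by move=> /pre_eqP vw; apply/pre_eqP => c c0 cw cv; rewrite vw.
by move=> v w; apply/idP/idP; exact: s.
Qed.

Lemma pre_eq_trans : transitive pre_eq.
Proof.
move=> w v z /pre_eqP vw /pre_eqP wz; apply/pre_eqP => c c0 cv cz.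
have [c' [c'0 c'c c'w]] := pdef_dense w c0.
rewrite -(pvalS c'0 c'c cv) -(pvalS c'0 c'c cz) vw//; last exact: pdefS cv.
by rewrite wz//; exact: pdefS cz.
Qed.

Canonical pre_eq_equiv := EquivRel pre_eq pre_eq_refl pre_eq_sym pre_eq_trans.

Definition specker : Type := {eq_quot pre_eq}.
HB.instance Definition _ := Choice.on specker.
HB.instance Definition _ := EqQuotient.on specker.

End PreSpecker.

Section Specker.
Context {R : realType} {d : Order.disp_t} {B : ctbDistrLatticeType d}.
Local Notation H := (specker R B).
Implicit Types (x y z : H) (a b c : B) (s : seq H) (v w : preSpecker R B).

Definition sval_at x c : R := pval (repr x) c.
Definition sdef_at x c : bool := pdef (repr x) c.

Lemma sdefS x c c' : c' <= c -> sdef_at x c -> sdef_at x c'.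
Proof. exact: pdefS. Qed.

Lemma svalS x c c' : c' != \bot -> c' <= c -> sdef_at x c ->
  sval_at x c' = sval_at x c.
Proof. exact: pvalS. Qed.

Lemma sdef_dense s c : c != \bot ->
  exists c', [/\ c' != \bot, c' <= c & all (sdef_at^~ c') s].
Proof.
move=> c0; elim: s => [|x s [c' [c'0 c'c c's]]]; first by exists c.
have [c2 [c20 c2c c2x]] := pdef_dense (repr x) c'0.
exists c2; split=> //; first exact: le_trans c'c.
rewrite /= [sdef_at _ _]c2x /=; apply: sub_all c's => y; exact: sdefS.
Qed.

Lemma specker_extP x y :
  reflect (forall c, c != \bot -> sdef_at x c -> sdef_at y c ->
             sval_at x c = sval_at y c) (x == y).
Proof.
apply: (iffP eqP) => [->//|xy].
by rewrite -[x]reprK -[y]reprK; apply/eqmodP/pre_eqP.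
Qed.

Lemma specker_ext s x y :
  (forall c, c != \bot -> sdef_at x c -> sdef_at y c ->
     all (sdef_at^~ c) s -> sval_at x c = sval_at y c) -> x = y.
Proof.
move=> xy; apply/eqP/specker_extP => c c0 cx cy.
have [c' [c'0 c'c c's]] := sdef_dense s c0.
rewrite -(svalS c'0 c'c cx) -(svalS c'0 c'c cy).
by apply: xy => //; [apply: sdefS cx | apply: sdefS cy].
Qed.

Lemma sval_pi v c : c != \bot -> pdef v c -> sdef_at (\pi_H v) c ->
  sval_at (\pi_H v) c = pval v c.
Proof.
move=> c0 cv cpi; have /eqmodP/pre_eqP : repr (\pi_H v) = v %[mod H].
  by rewrite reprK.
by apply.
Qed.

Definition specker_op (op : R -> R -> R) x y : H :=
  \pi_H (pre_op op (repr x) (repr y)).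
Definition specker_scale (r : R) x : H := \pi_H (pre_scale r (repr x)).
Definition specker_const (r : R) : H := \pi_H (pre_const B r).

Lemma sval_op op x y c : c != \bot -> sdef_at x c -> sdef_at y c ->
  sdef_at (specker_op op x y) c ->
  sval_at (specker_op op x y) c = op (sval_at x c) (sval_at y c).
Proof.
by move=> c0 cx cy cxy; rewrite sval_pi// ?pval_op//; apply: pdef_op.
Qed.

Lemma sval_scale r x c : c != \bot -> sdef_at x c ->
  sdef_at (specker_scale r x) c ->
  sval_at (specker_scale r x) c = r * sval_at x c.
Proof. by move=> c0 cx crx; rewrite sval_pi// pval_scale. Qed.

Lemma sval_const r c : c != \bot -> sdef_at (specker_const r) c ->
  sval_at (specker_const r) c = r.
Proof.
move=> c0 cr; have [c' [c'0 c'c c'd]] := pdef_dense (pre_const B r) c0.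
rewrite -(svalS c'0 c'c cr) sval_pi// ?pval_const//.
exact: sdefS cr.
Qed.

Lemma specker_op_pi op v w :
  specker_op op (\pi_H v) (\pi_H w) = \pi_H (pre_op op v w).
Proof.
apply: (@specker_ext [:: \pi_H v; \pi_H w]) => c c0 cvw cpi /=.
move=> /and3P[cv cw _].
have [c1 [c10 c1c c1v]] := pdef_dense v c0.
have [c' [c'0 c'c1 c'w]] := pdef_dense w c10.
have c'v := pdefS c'c1 c1v; have c'c := le_trans c'c1 c1c.
rewrite -(svalS c'0 c'c cvw) -(svalS c'0 c'c cpi).
rewrite sval_op ?(sdefS c'c)// !sval_pi ?(sdefS c'c)//; last exact: pdef_op.
by rewrite pval_op.
Qed.

Lemma specker_scale_pi r v : specker_scale r (\pi_H v) = \pi_H (pre_scale r v).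
Proof.
apply: (@specker_ext [:: \pi_H v]) => c c0 crv cpi /= /andP[cv _].
have [c' [c'0 c'c c'v]] := pdef_dense v c0.
rewrite -(svalS c'0 c'c crv) -(svalS c'0 c'c cpi).
by rewrite sval_scale ?(sdefS c'c)// !sval_pi ?(sdefS c'c)// pval_scale.
Qed.

Local Notation add := (specker_op +%R).
Local Notation meet := (specker_op Num.min).
Local Notation join := (specker_op Num.max).

Ltac sp_split := rewrite /=;
  repeat match goal with |- is_true (_ && _) -> _ =>
    let h := fresh "h" in move=> /andP[h] end; move=> _.
Ltac sp l := apply: (@specker_ext l) => c c0 ? ?; sp_split.

Let addA : associative add.
Proof.
move=> x y z; sp [:: x; y; z; add x y; add y z].
by rewrite !sval_op// addrA.
Qed.
Let addC : commutative add.
Proof. by move=> x y; sp [:: x; y]; rewrite !sval_op// addrC. Qed.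
Let add0 : left_id (specker_const 0) add.
Proof.
by move=> x; sp [:: x; specker_const 0]; rewrite !sval_op// sval_const// add0r.
Qed.
Let addN : left_inverse (specker_const 0) (specker_scale (- 1)) add.
Proof.
move=> x; sp [:: x; specker_scale (- 1) x].
by rewrite !sval_op// sval_const// sval_scale// mulN1r addNr.
Qed.
HB.instance Definition _ := GRing.isZmodule.Build H addA addC add0 addN.

Let scaleA (k l : R) x :
  specker_scale k (specker_scale l x) = specker_scale (k * l) x.
Proof.
by sp [:: x; specker_scale l x]; rewrite !sval_scale// mulrA.
Qed.
Let scale1 : left_id 1 specker_scale.
Proof. by move=> x; sp [:: x]; rewrite sval_scale// mul1r. Qed.
Let scaleDr : right_distributive specker_scale +%R.
Proof.
move=> k x y; sp [:: x; y; add x y; specker_scale k x; specker_scale k y].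
by rewrite !sval_op// !sval_scale// sval_op// mulrDr.
Qed.
Let scaleDl x : {morph specker_scale^~ x : k l / k + l}.
Proof.
move=> k l; sp [:: x; specker_scale k x; specker_scale l x].
by rewrite sval_op// !sval_scale// mulrDl.
Qed.
HB.instance Definition _ :=
  GRing.Zmodule_isLmodule.Build R H scaleA scale1 scaleDr scaleDl.

(* the order determined by the meet *)
Definition specker_le x y : bool := meet x y == x.

Lemma specker_leP x y :
  reflect (forall c, c != \bot -> sdef_at x c -> sdef_at y c ->
             (sval_at x c <= sval_at y c)%R) (specker_le x y).
Proof.
apply: (iffP idP) => [/specker_extP xy c c0 cx cy|xy].
  have [c' [c'0 c'c /=/andP[c'xy _]]] := sdef_dense [:: meet x y] c0.
  rewrite -(svalS c'0 c'c cx) -(svalS c'0 c'c cy).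
  have c'x := sdefS c'c cx; have c'y := sdefS c'c cy.
  by have := xy _ c'0 c'xy c'x; rewrite sval_op// => /eqP; rewrite eq_minl.
apply/eqP; sp [:: x; y].
by rewrite sval_op//; apply/min_idPl; apply: xy.
Qed.

Lemma specker_le_ext s x y :
  (forall c, c != \bot -> sdef_at x c -> sdef_at y c ->
     all (sdef_at^~ c) s -> (sval_at x c <= sval_at y c)%R) -> specker_le x y.
Proof.
move=> xy; apply/specker_leP => c c0 cx cy.
have [c' [c'0 c'c c's]] := sdef_dense s c0.
rewrite -(svalS c'0 c'c cx) -(svalS c'0 c'c cy).
by apply: xy => //; [apply: sdefS cx | apply: sdefS cy].
Qed.

Ltac sp_le l := apply: (@specker_le_ext l) => c c0 ? ?; sp_split.

Let le_refl : reflexive specker_le.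
Proof. by move=> x; apply/specker_leP. Qed.
Let le_anti : antisymmetric specker_le.
Proof.
move=> x y /andP[/specker_leP xy /specker_leP yx]; sp ([::] : seq H).
by apply/le_anti; rewrite xy// yx.
Qed.
Let le_trans : transitive specker_le.
Proof.
move=> y x z /specker_leP xy /specker_leP yz; sp_le [:: y].
by apply: (le_trans (xy _ _ _ _) (yz _ _ _ _)).
Qed.
Let lexI x y z : specker_le x (meet y z) = specker_le x y && specker_le x z.
Proof.
apply/idP/andP => [/specker_leP xyz|[/specker_leP xy /specker_leP xz]].
  split; sp_le [:: y; z; meet y z].
    have : (sval_at x c <= sval_at (meet y z) c)%R by exact: xyz.
    by rewrite sval_op// le_min => /andP[].
  have : (sval_at x c <= sval_at (meet y z) c)%R by exact: xyz.
    by rewrite sval_op// le_min => /andP[].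
by sp_le [:: y; z]; rewrite sval_op// le_min xy//= xz.
Qed.
Let leUx x y z : specker_le (join x y) z = specker_le x z && specker_le y z.
Proof.
apply/idP/andP => [/specker_leP xyz|[/specker_leP xz /specker_leP yz]].
  split; sp_le [:: x; y; join x y].
    have : (sval_at (join x y) c <= sval_at z c)%R by exact: xyz.
    by rewrite sval_op// ge_max => /andP[].
  have : (sval_at (join x y) c <= sval_at z c)%R by exact: xyz.
    by rewrite sval_op// ge_max => /andP[].
by sp_le [:: x; y]; rewrite sval_op// ge_max xz//= yz.
Qed.
Let le_add2l z x y : specker_le x y -> specker_le (z + x) (z + y).
Proof.
move=> /specker_leP xy; sp_le [:: x; y; z].
by rewrite !sval_op// lerD2l xy.
Qed.
Let le_scale (r : R) x : 0 <= r -> specker_le 0 x -> specker_le 0 (r *: x).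
Proof.
move=> r0 /specker_leP x0; sp_le [:: x].
rewrite sval_const// sval_scale// mulr_ge0//.
by have := x0 c; rewrite sval_const//; apply.
Qed.
HB.instance Definition _ := @Lmodule_isVectorLattice.Build R H
  specker_le meet join le_refl le_anti le_trans lexI leUx le_add2l le_scale.

End Specker.

Section SpeckerObject.
Context (R : realType) {d : Order.disp_t} (B : ctbDistrLatticeType d).
Local Notation H := (specker R B : vectLatticeType R).
Implicit Types (x y : specker R B) (b c : B).

Definition specker_unit : specker R B := specker_const 1.

Lemma svalD x y c : c != \bot -> sdef_at x c -> sdef_at y c ->
  sdef_at (x + y) c -> sval_at (x + y) c = sval_at x c + sval_at y c.
Proof. exact: sval_op. Qed.

Lemma svalZ r x c : c != \bot -> sdef_at x c -> sdef_at (r *: x) c ->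
  sval_at (r *: x) c = r * sval_at x c.
Proof. exact: sval_scale. Qed.

Lemma svalI (x y : H) c : c != \bot -> sdef_at x c -> sdef_at y c ->
  sdef_at (x `&` y) c ->
  sval_at (x `&` y) c = Num.min (sval_at x c) (sval_at y c).
Proof. exact: sval_op. Qed.

Lemma svalU (x y : H) c : c != \bot -> sdef_at x c -> sdef_at y c ->
  sdef_at (x `|` y) c ->
  sval_at (x `|` y) c = Num.max (sval_at x c) (sval_at y c).
Proof. exact: sval_op. Qed.

Lemma sval0 c : c != \bot -> sdef_at (0 : specker R B) c ->
  sval_at (0 : specker R B) c = 0.
Proof. exact: sval_const. Qed.

Lemma sval1 c : c != \bot -> sdef_at specker_unit c ->
  sval_at specker_unit c = 1.
Proof. exact: sval_const. Qed.

Lemma svalleP (x y : H) :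
  reflect (forall c, c != \bot -> sdef_at x c -> sdef_at y c ->
             (sval_at x c <= sval_at y c)%R) (x <= y).
Proof. exact: specker_leP. Qed.

Lemma specker_weak_unit : weak_unit (specker_unit : H).
Proof.
split=> [|v uv].
  by apply/svalleP => c c0 d0 d1; rewrite sval0// sval1.
apply: (@specker_ext _ _ _ [:: specker_unit; (specker_unit : H) `&` v]).
move=> c c0 dv d0 /= /and3P[du duv _].
have := svalI c0 du dv duv; rewrite uv sval0// sval1//.
by case: ltP => [_ /eqP|_ ->//]; rewrite eq_sym oner_eq0.
Qed.

Lemma specker_stable (x y : H) : 0 <= x -> 0 <= y ->
  exists N : nat, forall n, (N <= n)%N ->
    (n%:R *: x) `&` y = (N%:R *: x) `&` y.
Proof.
move=> /svalleP x0 /svalleP y0.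
pose M (b1 : pdom (repr x)) (b2 : pdom (repr y)) : nat :=
  Num.bound (pfun b2 / pfun b1).
pose N := (\max_b1 \max_b2 M b1 b2)%N.
have Nx (b1 : pdom (repr x)) (b2 : pdom (repr y)) : (0 < pfun b1)%R -> (0 <= pfun b2)%R ->
    (pfun b2 <= N%:R * pfun b1)%R.
  move=> b10 b20; rewrite -ler_pdivrMr//.
  have /ltW/le_trans := archi_boundP (divr_ge0 b20 (ltW b10)); apply.
  rewrite ler_nat (leq_trans _ (leq_bigmax b1))//.
  exact: (@leq_bigmax _ (M b1)).
exists N => n Nn.
apply: (@specker_ext _ _ _
  [:: x; y; 0; n%:R *: x; N%:R *: x]).
move=> c c0 d1 d2 /= /and5P[dx dy d0 dnx /andP[dNx _]].
rewrite !svalI// !svalZ//.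
have xge0 : (0 <= sval_at x c)%R by have := x0 c c0 d0 dx; rewrite sval0.
have yge0 : (0 <= sval_at y c)%R by have := y0 c c0 d0 dy; rewrite sval0.
have [b1 [cb1 xb1]] := pdefP c0 dx.
have [b2 [cb2 yb2]] := pdefP c0 dy.
rewrite /sval_at xb1 yb2 in xge0 yge0 *.
move: xge0; rewrite le_eqVlt => /predU1P[<-|xgt0]; first by rewrite !mulr0.
have le1 := Nx _ _ xgt0 yge0.
have le2 : (pfun b2 <= n%:R * pfun b1)%R.
  by apply: (le_trans le1); rewrite ler_pM2r// ler_nat.
by rewrite !min_r.
Qed.

Lemma specker_hyperarchimedean : hyperarchimedean H.
Proof.
move=> W f [fl fI fU] fsurj v w v0 vw; apply: contrapT => noarch.
have f0 : f 0 = 0.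
  by have := fl (- 1) 0 0; rewrite scaler0 addr0 scaleN1r addNr.
have fZ r x : f (r *: x) = r *: f x.
  by have := fl r x 0; rewrite f0 !addr0.
have [x0 fx0] := fsurj v; have [y0 fy0] := fsurj w.
pose x := (x0 : H) `|` 0; pose y := (y0 : H) `|` 0.
have fx : f x = v by rewrite fU fx0 f0; apply/join_idPl/ltW.
have fy : f y = w.
  by rewrite fU fy0 f0; apply/join_idPl; apply: le_trans vw; apply: ltW.
have [N NE] := @specker_stable x y (leUr _ _) (leUr _ _).
have nv n : n%:R *: v <= w.
  case: n => [|n]; first by rewrite scale0r (le_trans (ltW v0)).
  rewrite scaler_nat; apply: contrapT => nvw; apply: noarch.
  by exists n.+1.
have fn n : f ((n%:R *: x) `&` y) = n%:R *: v.
  by rewrite fI fZ fx fy; apply/meet_idPl.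
have := congr1 f (NE N.+1 (leqnSn N)); rewrite !fn !scaler_nat mulrS.
move/(congr1 (fun t => t - v *+ N)); rewrite addrK subrr => v00.
by rewrite v00 ltxx in v0.
Qed.

Definition specker_uHA : uHA_obj R :=
  UHA specker_weak_unit specker_hyperarchimedean.

End SpeckerObject.

Section SpeckerMap.
Context (R : realType) {d d' : Order.disp_t}.
Context (B : ctbDistrLatticeType d) (A : ctbDistrLatticeType d').
Variable f : boolHom B A.
Implicit Types (v w : preSpecker R B) (x y : specker R B).

Lemma bool_le b c : b <= c -> f b <= f c.
Proof. by rewrite !leEmeet -bool_meet => /eqP ->. Qed.

Definition part_image (P : {fset B}) : {fset A} :=
  [fset a in [fset f b | b in P] | a != \bot%O]%fset.

Lemma part_imageP P a :
  reflect (a != \bot /\ exists2 b, b \in P & a = f b) (a \in part_image P).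
Proof.
rewrite !inE /=; apply: (iffP andP) => [[/imfsetP[b /= bP ->] ?]|].
  by split=> //; exists b.
by move=> [a0 [b bP ab]]; split=> //; apply/imfsetP; exists b.
Qed.

Lemma pdom_join v : \join_(b <- pdom v) b = \top.
Proof.
set j := \join_(b <- _) b; apply/eqP; apply: contrapT => /negP j1.
have cj0 : ~` j != \bot by apply: contraNneq j1 => e; rewrite -(complK j) e compl0.
have [b bv] := pdom_cover v cj0.
have bj : b <= j by rewrite /j (big_rem b)//= leUl.
by rewrite -(meet_r bj) meetA meetCx meet0x eqxx.
Qed.

Lemma image_cover v a : a != \bot ->
  exists2 b, b \in pdom v & a `&` f b != \bot.
Proof.
move=> a0; apply: contrapT => nb; move/eqP: a0; apply.
rewrite -[LHS]meetx1 -(bool_top f) -(pdom_join v).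
rewrite (big_morph f (bool_join f) (bool_bot f)) big_seq.
apply: (big_ind (fun j => a `&` j = \bot)) => [|j k aj ak|b bv].
- by rewrite meetx0.
- by rewrite meetUr aj ak joinxx.
- by apply/eqP; apply: contrapT => /negP ab; apply: nb; exists b.
Qed.

Lemma image_partition v : is_partition [set` part_image (pdom v)].
Proof.
apply/is_partitionP; split.
  split=> [/= /part_imageP[]|a a' /= /part_imageP[a0 [b bv ->]]].
    by rewrite eqxx.
  move=> /part_imageP[a'0 [b' b'v ->]] bb'.
  rewrite -bool_meet; have [[_ vd] _] := pdomP v.
  by rewrite vd ?bool_bot// => e; apply: bb'; rewrite e.
move=> a a0; have [b bv ab] := image_cover v a0.
exists (f b) => //=; apply/part_imageP; split; last by exists b.
by apply: contraNneq ab => ->; rewrite meetx0.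
Qed.

(* value of v at the unique b in its domain with f b = a, when there is one *)
Definition image_val v (a : A) : R :=
  if [pick b : pdom v | f (val b) == a] is Some b then pfun b else 0.

(* v b at f b, see pre_mapE *)
Definition pre_map v : preSpecker R A :=
  @mkPre R _ A [fmap a : part_image (pdom v) => image_val v (val a)]
    (image_partition v).

Lemma pre_mapE v (b : pdom v) (a : pdom (pre_map v)) :
  val a = f (val b) -> pfun a = pfun b.
Proof.
move=> ab; rewrite [LHS]/pfun ffunE /image_val; case: pickP => [b' /eqP fb'|/(_ b)].
  congr pfun; apply: val_inj; apply: contrapT => bb'.
  have [[_ vd] _] := pdomP v.
  have := pdom_neq0 (fsvalP a).
  have : f (val b' `&` val b) = \bot by rewrite vd ?bool_bot//; exact: fsvalP.
  by rewrite bool_meet fb' -ab meetxx => ->; rewrite eqxx.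
by rewrite ab eqxx.
Qed.

Lemma pdef_map v a c : a != \bot -> a <= f c -> pdef v c -> pdef (pre_map v) a.
Proof.
move=> a0 ac /existsP[b cb].
have afb : a <= f (val b) by apply: le_trans (bool_le cb).
have bP : f (val b) \in pdom (pre_map v).
  apply/part_imageP; split; last by exists (val b) => //; exact: fsvalP.
  by apply: contraNneq a0 => e; rewrite -lex0 -e.
by apply/existsP; exists [` bP]%fset.
Qed.

Lemma pval_map v a c : a != \bot -> a <= f c -> pdef v c ->
  pval (pre_map v) a = pval v c.
Proof.
move=> a0 ac cv.
have c0 : c != \bot.
  by apply: contraNneq a0 => e; rewrite -lex0 -(bool_bot f) -e.
have [b [cb ->]] := pdefP c0 cv.
have afb : a <= f (val b) by apply: le_trans (bool_le cb).
have bP : f (val b) \in pdom (pre_map v).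
  apply/part_imageP; split; last by exists (val b) => //; exact: fsvalP.
  by apply: contraNneq a0 => e; rewrite -lex0 -e.
by rewrite (@pvalE _ _ _ _ a [` bP]%fset)//; apply: pre_mapE.
Qed.

Definition specker_map x : specker R A := \pi_(specker R A) (pre_map (repr x)).

Lemma sval_map x a c : a != \bot -> a <= f c -> sdef_at x c ->
  sdef_at (specker_map x) a -> sval_at (specker_map x) a = sval_at x c.
Proof.
move=> a0 ac cx am; rewrite sval_pi//; first exact: pval_map ac cx.
exact: pdef_map ac cx.
Qed.

Lemma sdef_dense_map (s : seq (specker R B)) a : a != \bot ->
  exists a' c, [/\ a' != \bot, a' <= a, a' <= f c & all (sdef_at^~ c) s].
Proof.
move=> a0; elim: s => [|x s [a1 [c1 [a10 a1a a1c1 c1s]]]].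
  by exists a, \top; rewrite bool_top lex1.
have [b bx a1b] := image_cover (repr x) a10.
exists (a1 `&` f b), (c1 `&` b); split=> //.
- exact: (le_trans (leIl _ _)).
- by rewrite bool_meet leI2.
- apply/andP; split; last first.
    by apply: sub_all c1s => y; apply: sdefS; exact: leIl.
  by apply/existsP; exists [` bx]%fset; rewrite leIr.
Qed.

Lemma specker_ext_map (s : seq (specker R B)) (t : seq (specker R A))
    (x y : specker R A) :
  (forall a c, a != \bot -> a <= f c -> sdef_at x a -> sdef_at y a ->
     all (sdef_at^~ c) s -> all (sdef_at^~ a) t -> sval_at x a = sval_at y a) ->
  x = y.
Proof.
move=> xy; apply: (@specker_ext _ _ _ t) => a a0 ax ay at_.
have [a' [c [a'0 a'a a'c cs]]] := sdef_dense_map s a0.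
rewrite -(svalS a'0 a'a ax) -(svalS a'0 a'a ay).
apply: xy a'c _ _ cs _ => //; [exact: sdefS ax|exact: sdefS ay|].
by apply: sub_all at_ => z; exact: sdefS.
Qed.

Lemma specker_map_pi v :
  specker_map (\pi_(specker R B) v) = \pi_(specker R A) (pre_map v).
Proof.
apply: (@specker_ext_map [:: \pi_(specker R B) v] [::]).
move=> a c a0 ac am api /= /andP[cv _] _.
have [b bv ab] := image_cover v a0.
have cb0 : c `&` b != \bot.
  apply: contraNneq ab => e; rewrite -lex0 -(bool_bot f) -e bool_meet leI2//.
have a'c : a `&` f b <= f (c `&` b) by rewrite bool_meet leI2.
have cbv : pdef v (c `&` b) by apply/existsP; exists [` bv]%fset; rewrite leIr.
have leab : a `&` f b <= a by exact: leIl.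
rewrite -(svalS ab leab am) -(svalS ab leab api).
have cbpi := sdefS (leIl c b) cv.
rewrite (sval_map ab a'c)//; last exact: sdefS am.
rewrite !sval_pi//; last first.
- exact: sdefS api.
- exact: pdef_map a'c cbv.
by rewrite (pval_map ab a'c).
Qed.

Lemma specker_map_linear_lattice :
  linear_lattice_hom
    (specker_map : (specker R B : vectLatticeType R) ->
                   (specker R A : vectLatticeType R)).
Proof.
split=> [r x y|x y|x y].
- apply: (@specker_ext_map [:: x; y; r *: x; r *: x + y]
    [:: specker_map x; specker_map y; r *: specker_map x]).
  move=> a c a0 ac d1 d2 /= /and5P[cx cy crx crxy _] /and4P[ax ay arx _].
  have c0 : c != \bot.
    by apply: contraNneq a0 => e; rewrite -lex0 -(bool_bot f) -e.
  by rewrite (sval_map a0 ac)// !svalD// !svalZ// !(sval_map a0 ac).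
- apply: (@specker_ext_map
    [:: x; y; ((x : (specker R B : vectLatticeType R)) `&` y)]
    [:: specker_map x; specker_map y]).
  move=> a c a0 ac d1 d2 /= /and4P[cx cy cxy _] /and3P[ax ay _].
  have c0 : c != \bot.
    by apply: contraNneq a0 => e; rewrite -lex0 -(bool_bot f) -e.
  by rewrite (sval_map a0 ac)// !svalI// !(sval_map a0 ac).
- apply: (@specker_ext_map
    [:: x; y; ((x : (specker R B : vectLatticeType R)) `|` y)]
    [:: specker_map x; specker_map y]).
  move=> a c a0 ac d1 d2 /= /and4P[cx cy cxy _] /and3P[ax ay _].
  have c0 : c != \bot.
    by apply: contraNneq a0 => e; rewrite -lex0 -(bool_bot f) -e.
  by rewrite (sval_map a0 ac)// !svalU// !(sval_map a0 ac).
Qed.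

Lemma specker_map_unit : specker_map (specker_unit R B) = specker_unit R A.
Proof.
apply: (@specker_ext_map [:: specker_unit R B] [::]).
move=> a c a0 ac d1 d2 /= /andP[c1 _] _.
have c0 : c != \bot.
  by apply: contraNneq a0 => e; rewrite -lex0 -(bool_bot f) -e.
by rewrite (sval_map a0 ac)// !sval1.
Qed.

Definition Hfun_hom : uHA_hom (specker_uHA R B) (specker_uHA R A) :=
  @UHAHom R (specker_uHA R B) (specker_uHA R A) specker_map
    specker_map_linear_lattice specker_map_unit.

End SpeckerMap.

Section SpeckerFunctor.
Context (R : realType).

Lemma specker_map_id d (B : ctbDistrLatticeType d) (x : specker R B) :
  specker_map (id_boolHom B) x = x.
Proof.
apply: (@specker_ext _ _ _ [::]) => c c0 d1 d2 _.
by apply: sval_map => //=; exact: lexx.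
Qed.

Lemma specker_map_comp d1 d2 d3 (A : ctbDistrLatticeType d1)
  (B : ctbDistrLatticeType d2) (C : ctbDistrLatticeType d3)
  (g : boolHom B C) (f : boolHom A B) (x : specker R A) :
  specker_map (comp_boolHom g f) x = specker_map g (specker_map f x).
Proof.
apply: (@specker_ext_map _ _ _ _ _ (comp_boolHom g f) [:: x] [::]).
move=> a c a0 ac e1 e2 /= /andP[cx _] _.
rewrite (sval_map a0 ac)//.
have [a' [b [a'0 a'a a'b /= /andP[bf _]]]] :=
  sdef_dense_map g [:: specker_map f x] a0.
have le1 : a' <= g (b `&` f c).
  by rewrite bool_meet lexI a'b (le_trans a'a ac).
have b0 : b `&` f c != \bot.
  by apply: contraNneq a'0 => e; rewrite -lex0 -(bool_bot g) -e.
rewrite -(svalS a'0 a'a e2) (sval_map a'0 le1); last exact: sdefS e2.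
  by rewrite (sval_map b0 (leIr _ _))//; apply: sdefS bf; exact: leIl.
by apply: sdefS bf; exact: leIl.
Qed.

Definition Hfun : functor BA (uHA R).
Proof.
refine (@Functor BA (uHA R) (fun B => specker_uHA R (B : ctbDistrLatticeType _))
  (fun A B f => Hfun_hom R f) _ _).
- by move=> B; apply: uHA_hom_eq => x; exact: specker_map_id.
- by move=> A B C g f; apply: uHA_hom_eq => x; exact: specker_map_comp.
Defined.

End SpeckerFunctor.

(* Main.v *)
From HB Require Import structures.
From mathcomp Require Import all_boot all_order all_algebra.
From mathcomp Require Import finmap.
From mathcomp Require Import boolp classical_sets reals.
Require Import Defs.
From mathcomp Require Import reals.

(** The two natural isomorphisms are the indicator map B -> B(H(B)) and the
    evaluation map H(B(V)) -> V, which sends v : P -> R to the sum of the v(b) b.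
    Both are controlled locally: x in H(B) takes the value r on a block c, and
    z in V is equal to r u on c, meaning |z - r u| `&` c = 0.  Finitely many
    elements of H(B) are constant on each member of a dense set of blocks, and
    elements of V which agree on a dense set of blocks are equal, because
    every a >= 0 in V has a Boolean support.

    Boolean supports come from hyperarchimedeanness.  Let I be the ideal generated
    by all (n a - u)^+.  In V / I the multiples of a are bounded by u, so a = 0
    there, i.e. a <= r (s a - u)^+ for some r and s, and then s a `&` u is Boolean.

    The evaluation map is onto: applied to (z - r u)^+ and (r u - z)^+, Boolean
    supports show that near r the truncation z `&` r u changes, on each side of r,
    by multiples of one Boolean element.  Hence the set of the r for which z `&` r u
    is a value of the evaluation map contains its supremum, and cannot stop
    before r u >= z. *)

Set Implicit Arguments.
Unset Strict Implicit.
Unset Printing Implicit Defensive.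

Import Order.Theory GRing.Theory Num.Theory.
Local Open Scope quotient_scope.
Local Open Scope ring_scope.
Local Open Scope order_scope.

(** * Scaling, absolute value and disjointness in vector lattices *)

Section VectorLatticeArithmetic.
Context {R : realType} {V : vectLatticeType R}.
Implicit Types (x y z : V) (r s : R).

Lemma vl_scale_le2l r x y : 0 <= r -> x <= y -> r *: x <= r *: y.
Proof. by move=> r0 xy; rewrite -vl_subr_ge0 -scalerBr vl_scale_ge0// vl_subr_ge0. Qed.

Lemma vl_scale_le2r r s x : r <= s -> 0 <= x -> r *: x <= s *: x.
Proof. by move=> rs x0; rewrite -vl_subr_ge0 -scalerBl vl_scale_ge0// subr_ge0. Qed.

Lemma vl_scale_le2l_pos r x y : 0 < r -> (r *: x <= r *: y) = (x <= y).
Proof.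
move=> r0; apply/idP/idP; last by apply: vl_scale_le2l; exact: ltW.
move=> /(@vl_scale_le2l r^-1); rewrite !scalerA mulVf ?gt_eqF// !scale1r.
by apply; rewrite invr_ge0 ltW.
Qed.

(** For r > 0 scaling is an order automorphism: the nontrivial inequality is checked after scaling
    back by [r^-1]. *)
Lemma vl_scaleI r x y : 0 <= r -> r *: (x `&` y) = (r *: x) `&` (r *: y).
Proof.
rewrite le_eqVlt => /predU1P[<-|r0]; first by rewrite !scale0r meetxx.
apply/le_anti/andP; split; first by rewrite lexI !vl_scale_le2l_pos// leIl leIr.
have rV : r * r^-1 = 1 by rewrite divff ?gt_eqF.
have rVr z : r *: (r^-1 *: z) = z by rewrite scalerA rV scale1r.
rewrite -[X in X <= _]rVr vl_scale_le2l_pos// lexI.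
rewrite -(vl_scale_le2l_pos _ x r0) -(vl_scale_le2l_pos _ y r0) rVr.
by rewrite leIl leIr.
Qed.

Lemma vl_scaleU r x y : 0 <= r -> r *: (x `|` y) = (r *: x) `|` (r *: y).
Proof.
move=> r0; rewrite -[x `|` y]opprK vl_oppU scalerN vl_scaleI// vl_oppI !scalerN.
by rewrite !opprK.
Qed.

Definition vl_abs x : V := x `|` - x.

Lemma vl_le_abs x : x <= vl_abs x. Proof. exact: leUl. Qed.
Lemma vl_leN_abs x : - x <= vl_abs x. Proof. exact: leUr. Qed.

Lemma vl_absN x : vl_abs (- x) = vl_abs x.
Proof. by rewrite /vl_abs opprK joinC. Qed.

Lemma vl_absB x y : vl_abs (x - y) = vl_abs (y - x).
Proof. by rewrite -vl_absN opprB. Qed.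

Lemma vl_abs_ge0 x : 0 <= vl_abs x.
Proof.
have := vl_leD (vl_le_abs x) (vl_leN_abs x); rewrite subrr -mulr2n -scaler_nat.
by rewrite -[X in X <= _](scaler0 _ 2%:R) vl_scale_le2l_pos// ltr0n.
Qed.

Lemma vl_ge0_abs x : 0 <= x -> vl_abs x = x.
Proof.
by move=> x0; apply/join_idPl; rewrite (le_trans _ x0)// -[leRHS]oppr0 vl_leN2.
Qed.

Lemma vl_abs_eq0 x : vl_abs x = 0 -> x = 0.
Proof.
move=> x0; apply/le_anti; rewrite -{1}x0 vl_le_abs -vl_leN2 oppr0 -x0.
exact: vl_leN_abs.
Qed.

Lemma vl_absD x y : vl_abs (x + y) <= vl_abs x + vl_abs y.
Proof. by rewrite leUx opprD !vl_leD ?vl_le_abs ?vl_leN_abs. Qed.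

Lemma vl_absZ r x : vl_abs (r *: x) = `|r|%R *: vl_abs x.
Proof.
have [r0|/ltW r0] := ger0P r.
  by rewrite /vl_abs vl_scaleU// scalerN.
rewrite /vl_abs vl_scaleU ?oppr_ge0// scalerN !scaleNr opprK.
by rewrite joinC.
Qed.

(** Truncation is 1-Lipschitz since x <= y + |x - y|. This makes meets compatible with congruence
    modulo an ideal. *)
Lemma vl_abs_meetl x y z : vl_abs ((x `&` z) - (y `&` z)) <= vl_abs (x - y).
Proof.
have aux (x' y' : V) : (x' `&` z) - (y' `&` z) <= vl_abs (x' - y').
  rewrite -(vl_leD2r (y' `&` z)) subrK vl_addI leI2//.
    by rewrite -(vl_leD2r (- y')) addrK vl_le_abs.
  by rewrite -[leLHS]add0r vl_leD2r vl_abs_ge0.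
by rewrite leUx aux opprB vl_absB aux.
Qed.

Lemma vl_posI_neg x : (x `|` 0) `&` (- x `|` 0) = 0.
Proof.
rewrite -joinIl; apply/join_idPr; rewrite -vl_leN2 oppr0 vl_oppI opprK joinC.
exact: vl_abs_ge0.
Qed.

Lemma vl_posBneg x : (x `|` 0) - (- x `|` 0) = x.
Proof.
rewrite -{2}[0]oppr0 -vl_oppI opprK addrC vl_meetDjoin addr0//.
Qed.

Lemma vl_subI x y : x - (x `&` y) = (x - y) `|` 0.
Proof. by rewrite vl_oppI vl_addU subrr joinC. Qed.

(** The right-hand side is the meet of x + y, x + z, z + y and z + z, and the last three sums are at
    least z. *)
Lemma vl_meetD_le x y z : 0 <= x -> 0 <= y -> 0 <= z ->
  (x + y) `&` z <= (x `&` z) + (y `&` z).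
Proof.
move=> x0 y0 z0; rewrite vl_addI lexI.
rewrite ![(x `&` z) + _]addrC !vl_addI !lexI.
rewrite [y + x]addrC [z + x]addrC leIl.
by rewrite !(le_trans (leIr _ _))//; rewrite -[leLHS]add0r vl_leD2r.
Qed.

Lemma vl_disjointZ r x y : 0 <= r -> 0 <= x -> 0 <= y ->
  x `&` y = 0 -> (r *: x) `&` y = 0.
Proof.
(* The factor r + 1 dominates both r and 1, so both r x and y lie below the (r + 1)-fold multiples,
   whose meet is (r + 1)(x [&] y) = 0. *)
move=> r0 x0 y0 xy; have r10 : 0 <= r + 1 by rewrite addr_ge0.
apply/le_anti; rewrite lexI vl_scale_ge0// y0 andbT.
rewrite -[X in _ <= X](scaler0 _ (r + 1)) -xy vl_scaleI// leI2//.
  by rewrite vl_scale_le2r// lerDl.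
by rewrite -[leLHS]scale1r vl_scale_le2r// lerDr.
Qed.

Lemma vl_disjoint_le x x' y : 0 <= x' -> 0 <= y -> x' <= x ->
  x `&` y = 0 -> x' `&` y = 0.
Proof.
move=> x0 y0 xx' xy; apply/le_anti; rewrite lexI x0 y0 !andbT -xy.
by rewrite leI2.
Qed.

End VectorLatticeArithmetic.

(** * Ideals and the congruences they define *)

Section VectorLatticeIdeal.
Context {R : realType} {V : vectLatticeType R}.
Implicit Types (x y z : V) (r s : R).

(** The last clause packs solidity and closure under scalar multiples into one condition. *)
Definition vl_ideal (I : V -> Prop) : Prop :=
  [/\ I 0, forall x y, I x -> I y -> I (x + y) &
      forall x y r, I x -> vl_abs y <= r *: vl_abs x -> I y].

Context (I : V -> Prop) (idealI : vl_ideal I).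

Lemma ideal0 : I 0. Proof. by case: idealI. Qed.

Lemma idealD x y : I x -> I y -> I (x + y). Proof. by case: idealI => _ + _; apply. Qed.

Lemma ideal_le x y : I x -> vl_abs y <= vl_abs x -> I y.
Proof. by case: idealI => _ _ h Ix yx; apply: (h _ _ 1 Ix); rewrite scale1r. Qed.

Lemma idealZ r x : I x -> I (r *: x).
Proof. by case: idealI => _ _ h Ix; apply: (h x _ `|r|%R) => //; rewrite vl_absZ. Qed.

Lemma idealN x : I x -> I (- x).
Proof. by rewrite -scaleN1r; exact: idealZ. Qed.

Lemma ideal_subr x y : I (x - y) -> I (y - x).
Proof. by move=> /idealN; rewrite opprB. Qed.

Lemma ideal_trans x y z : I (x - y) -> I (y - z) -> I (x - z).
Proof. by move=> xy yz; have := idealD xy yz; rewrite addrA subrK. Qed.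

Lemma ideal_congrD x x' y y' : I (x - x') -> I (y - y') -> I (x + y - (x' + y')).
Proof. by move=> xx' yy'; rewrite opprD addrACA; exact: idealD. Qed.

Lemma ideal_congrZ r x x' : I (x - x') -> I (r *: x - r *: x').
Proof. by rewrite -scalerBr; exact: idealZ. Qed.

Lemma ideal_congrI x x' y y' :
  I (x - x') -> I (y - y') -> I ((x `&` y) - (x' `&` y')).
Proof.
(* One argument is replaced at a time, each change being bounded by [vl_abs_meetl]. *)
move=> xx' yy'; apply: (@ideal_trans _ (x' `&` y)).
  by apply: ideal_le xx' _; exact: vl_abs_meetl.
rewrite ![x' `&` _]meetC.
by apply: ideal_le yy' _; exact: vl_abs_meetl.
Qed.

Lemma ideal_congrU x x' y y' :
  I (x - x') -> I (y - y') -> I ((x `|` y) - (x' `|` y')).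
Proof.
move=> xx' yy'; rewrite -[_ `|` _]opprK -[x' `|` _]opprK !vl_oppU opprK addrC.
by apply: ideal_congrI; rewrite opprK addrC.
Qed.

End VectorLatticeIdeal.

(** * The quotient of a vector lattice by an ideal *)

Section Quotient.
Context {R : realType} {V : vectLatticeType R}.
Context (I : V -> Prop) (idealI : vl_ideal I).
Implicit Types (x y z : V).

Definition quot_eq x y : bool := `[< I (x - y) >].

Lemma quot_eq_refl : reflexive quot_eq.
Proof. by move=> x; apply/asboolP; rewrite subrr; exact: ideal0. Qed.

Lemma quot_eq_sym : symmetric quot_eq.
Proof. by move=> x y; apply: asbool_equiv_eq; split; exact: ideal_subr. Qed.

Lemma quot_eq_trans : transitive quot_eq.
Proof. move=> y x z /asboolP xy /asboolP yz; apply/asboolP; exact: ideal_trans xy yz. Qed.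

Definition quot_equiv := EquivRel quot_eq quot_eq_refl quot_eq_sym quot_eq_trans.

Definition quot : Type := {eq_quot quot_equiv}.
HB.instance Definition _ := Choice.on quot.
HB.instance Definition _ := EqQuotient.on quot.
Implicit Types (a b c : quot).

Local Notation pi := (\pi_quot : V -> quot).

Lemma quot_piP x y : pi x = pi y <-> I (x - y).
Proof. by split=> [/eqmodP/asboolP|xy]; [|apply/eqmodP/asboolP]. Qed.

Lemma quot_reprP x : I (repr (pi x) - x).
Proof. by apply/quot_piP; rewrite reprK. Qed.

(* Unlocked, the operations unify with \pi _ and rewriting with the lemmas below goes astray. *)
Definition quot_add := locked (fun a b => pi (repr a + repr b)).
Definition quot_opp := locked (fun a => pi (- repr a)).
Definition quot_scale := locked (fun (r : R) a => pi (r *: repr a)).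
Definition quot_meet := locked (fun a b => pi (repr a `&` repr b)).
Definition quot_join := locked (fun a b => pi (repr a `|` repr b)).

Lemma quot_addE x y : quot_add (pi x) (pi y) = pi (x + y).
Proof. by rewrite /quot_add -lock; apply/quot_piP; apply: ideal_congrD => //; exact: quot_reprP. Qed.
Lemma quot_scaleE r x : quot_scale r (pi x) = pi (r *: x).
Proof. by rewrite /quot_scale -lock; apply/quot_piP; apply: ideal_congrZ => //; exact: quot_reprP. Qed.
Lemma quot_oppE x : quot_opp (pi x) = pi (- x).
Proof. by rewrite /quot_opp -lock; apply/quot_piP; rewrite -opprD; apply: idealN => //; exact: quot_reprP. Qed.
Lemma quot_meetE x y : quot_meet (pi x) (pi y) = pi (x `&` y).
Proof. by rewrite /quot_meet -lock; apply/quot_piP; apply: ideal_congrI => //; exact: quot_reprP. Qed.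
Lemma quot_joinE x y : quot_join (pi x) (pi y) = pi (x `|` y).
Proof. by rewrite /quot_join -lock; apply/quot_piP; apply: ideal_congrU => //; exact: quot_reprP. Qed.

Definition quotE := (quot_addE, quot_oppE, quot_scaleE, quot_meetE, quot_joinE).

Let addA : associative quot_add.
Proof. by move=> a b c; rewrite -[a]reprK -[b]reprK -[c]reprK !quotE addrA. Qed.
Let addC : commutative quot_add.
Proof. by move=> a b; rewrite -[a]reprK -[b]reprK !quotE addrC. Qed.
Let add0 : left_id (pi 0) quot_add.
Proof. by move=> a; rewrite -[a]reprK !quotE add0r. Qed.
Let addN : left_inverse (pi 0) quot_opp quot_add.
Proof. by move=> a; rewrite -[a]reprK !quotE addNr. Qed.
HB.instance Definition _ := GRing.isZmodule.Build quot addA addC add0 addN.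

Let scaleA (k l : R) a : quot_scale k (quot_scale l a) = quot_scale (k * l) a.
Proof. by rewrite -[a]reprK !quotE scalerA. Qed.
Let scale1 : left_id 1 quot_scale.
Proof. by move=> a; rewrite -[a]reprK !quotE scale1r. Qed.
Let scaleDr : right_distributive quot_scale +%R.
Proof.
by move=> k a b; rewrite -[a]reprK -[b]reprK [_ + _]quotE !quotE scalerDr -quot_addE.
Qed.
Let scaleDl a : {morph quot_scale^~ a : k l / k + l}.
Proof. by move=> k l; rewrite -[a]reprK !quotE scalerDl -quot_addE. Qed.
HB.instance Definition _ :=
  GRing.Zmodule_isLmodule.Build R quot scaleA scale1 scaleDr scaleDl.

Lemma quot_piD x y : pi (x + y) = pi x + pi y.
Proof. by rewrite -quot_addE. Qed.
Lemma quot_piZ r x : pi (r *: x) = r *: pi x.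
Proof. by rewrite -quot_scaleE. Qed.

(** Defining the order by the meet reduces the order axioms to identities inherited from V. *)
Definition quot_le a b : bool := quot_meet a b == a.

Let quot_meetC : commutative quot_meet.
Proof. by move=> a b; rewrite -[a]reprK -[b]reprK !quotE meetC. Qed.
Let quot_meetA : associative quot_meet.
Proof. by move=> a b c; rewrite -[a]reprK -[b]reprK -[c]reprK !quotE meetA. Qed.
Let quot_meetxx a : quot_meet a a = a.
Proof. by rewrite -[a]reprK !quotE meetxx. Qed.
Let quot_meetUl : left_distributive quot_meet quot_join.
Proof. by move=> a b c; rewrite -[a]reprK -[b]reprK -[c]reprK !quotE meetUl. Qed.
Let quot_joinKI b a : quot_meet a (quot_join a b) = a.
Proof. by rewrite -[a]reprK -[b]reprK !quotE joinKI. Qed.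
Let quot_joinKIC b a : quot_meet a (quot_join b a) = a.
Proof. by rewrite -[a]reprK -[b]reprK !quotE joinKIC. Qed.

Let le_refl : reflexive quot_le.
Proof. by move=> a; rewrite /quot_le quot_meetxx. Qed.
Let le_anti : antisymmetric quot_le.
Proof. by move=> a b /andP[/eqP ab /eqP]; rewrite quot_meetC ab. Qed.
Let le_trans : transitive quot_le.
Proof.
by move=> b a c /eqP ab /eqP bc; rewrite /quot_le -ab -quot_meetA bc.
Qed.
Let lexI a b c : quot_le a (quot_meet b c) = quot_le a b && quot_le a c.
Proof.
apply/eqP/andP => [<-|[/eqP ab /eqP ac]]; last by rewrite quot_meetA ab.
split; apply/eqP; last by rewrite -!quot_meetA quot_meetxx.
by rewrite [quot_meet b c]quot_meetC -!quot_meetA quot_meetxx.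
Qed.
Let leUx a b c : quot_le (quot_join a b) c = quot_le a c && quot_le b c.
Proof.
apply/idP/andP => [abc|[/eqP ac /eqP bc]]; last first.
  by rewrite /quot_le quot_meetUl ac bc.
by split; apply: le_trans abc; apply/eqP.
Qed.
Let le_add2l c a b : quot_le a b -> quot_le (c + a) (c + b).
Proof.
rewrite -[a]reprK -[b]reprK -[c]reprK => /eqP; rewrite quotE => ab.
by rewrite /quot_le -!quot_piD quotE -vl_addI !quot_piD ab.
Qed.
Let le_scale (r : R) a : 0 <= r -> quot_le 0 a -> quot_le 0 (r *: a).
Proof.
rewrite -[a]reprK => r0 /eqP; rewrite quotE => a0.
by rewrite /quot_le -quot_piZ quotE -{1}(scaler0 V r) -vl_scaleI// quot_piZ a0 scaler0.
Qed.
HB.instance Definition _ := @Lmodule_isVectorLattice.Build R quot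
  quot_le quot_meet quot_join le_refl le_anti le_trans lexI leUx le_add2l le_scale.

(** This is all that is used of V / I from here on: a surjective homomorphism whose kernel is
    exactly I. *)
Lemma ideal_quotient : exists (W : vectLatticeType R) (f : V -> W),
  [/\ linear_lattice_hom f, forall w, exists v, f v = w &
      forall v, f v = 0 <-> I v].
Proof.
exists (quot : vectLatticeType R), pi; split.
- split=> [r x y|x y|x y]; last 2 first.
  + by rewrite -quot_meetE.
  + by rewrite -quot_joinE.
  by rewrite quot_piD quot_piZ.
- by move=> w; exists (repr w); rewrite reprK.
- by move=> v; rewrite -[X in I X]subr0; exact: quot_piP.
Qed.

End Quotient.

(** * Polars, and the bound drawn from hyperarchimedeanness *)

Section Hyperarchimedean.
Context {R : realType} {V : vectLatticeType R}.
Implicit Types (a b c x y z u : V) (r s : R).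

(** The polar of c; elements congruent modulo it are those that agree on c. *)
Definition vl_polar c x : Prop := vl_abs x `&` c = 0.

Lemma vl_ideal_polar c : 0 <= c -> vl_ideal (vl_polar c).
Proof.
move=> c0; split=> [|x y xc yc|x y r xc yx].
- by rewrite /vl_polar vl_ge0_abs//; apply/meet_idPl.
- apply: (@vl_disjoint_le _ _ (vl_abs x + vl_abs y)) => //.
  + exact: vl_abs_ge0.
  + exact: vl_absD.
  apply/le_anti; rewrite lexI c0 -{2}[0]addr0 vl_leD ?vl_abs_ge0// !andbT.
  by apply: le_trans (vl_meetD_le _ _ _) _; rewrite ?vl_abs_ge0// xc yc addr0.
- apply: (@vl_disjoint_le _ _ (`|r|%R *: vl_abs x)) => //.
  + exact: vl_abs_ge0.
  + by rewrite (le_trans yx)// vl_scale_le2r ?vl_abs_ge0// ler_norm.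
  by apply: vl_disjointZ => //; exact: vl_abs_ge0.
Qed.

Lemma vl_polarS c c' x : 0 <= c' -> c' <= c -> vl_polar c x -> vl_polar c' x.
Proof.
rewrite /vl_polar ![vl_abs x `&` _]meetC => c'0.
by apply: vl_disjoint_le => //; exact: vl_abs_ge0.
Qed.

(* The ideal of the header, with b in place of u: in V / I, n a <= b for all n. *)
Definition infinitesimal_ideal a b x : Prop :=
  exists r s, [/\ 0 <= r, 0 <= s & vl_abs x <= r *: ((s *: a - b) `|` 0)].

Lemma infinitesimal_idealP a b : 0 <= a -> vl_ideal (infinitesimal_ideal a b).
Proof.
move=> a0; split=> [|x y [r [s [r0 s0 xrs]]] [r' [s' [r'0 s'0 yrs]]]|].
- by exists 0, 0; rewrite scale0r vl_ge0_abs.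
(* As a >= 0, the positive part of s a - b increases with s, so the larger of s and s' serves both
   summands. *)
- exists (r + r'), (Num.max s s'); rewrite addr_ge0// le_max s0; split=> //.
  rewrite scalerDl (le_trans (vl_absD _ _))// vl_leD//.
    rewrite (le_trans xrs)// vl_scale_le2l// leU2// vl_leD2r vl_scale_le2r//.
    by rewrite le_max lexx.
  rewrite (le_trans yrs)// vl_scale_le2l// leU2// vl_leD2r vl_scale_le2r//.
  by rewrite le_max lexx orbT.
- move=> x y t [r [s [r0 s0 xrs]]] yx; exists (`|t|%R * r), s; split=> //.
    by rewrite mulr_ge0.
  rewrite (le_trans yx)// -scalerA (@le_trans _ _ (`|t|%R *: vl_abs x))//.
    by rewrite vl_scale_le2r ?vl_abs_ge0// ler_norm.
  exact: vl_scale_le2l.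
Qed.

Lemma hyperarchimedean_bound a b : hyperarchimedean V -> 0 <= a ->
  exists r s, [/\ 0 <= r, 0 <= s & a <= r *: ((s *: a - b) `|` 0)].
Proof.
move=> hypV a0; have Iab := infinitesimal_idealP b a0.
have [W [f [fH fsurj fker]]] := ideal_quotient Iab.
have arch := hypV W f fH fsurj; have [fl fI fU] := fH.
have f0 : f 0 = 0 by have := fl (- 1) 0 0; rewrite scaler0 addr0 scaleN1r addNr.
have fZ r x : f (r *: x) = r *: f x by have := fl r x 0; rewrite f0 !addr0.
have fB x y : f (x - y) = f x - f y.
  by rewrite addrC -scaleN1r fl scaleN1r addrC.
suff /fker[r [s []]] : f a = 0 by rewrite vl_ge0_abs//; exists r, s.
have le_n n : f a *+ n <= f b.
  (* The positive part of n a - b is a generator of the ideal, so it vanishes in the quotient and n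
     f(a) <= f(b) there. *)
  have fn : f ((n%:R *: a - b) `|` 0) = 0.
    apply/fker; exists 1, n%:R; rewrite scale1r vl_ge0_abs ?leUr// ler0n ler01.
  rewrite -scaler_nat -fZ -vl_subr_ge0 -vl_leN2 oppr0 opprB -fB.
  by rewrite -fn fU f0 leUl.
apply/eqP; apply: contrapT => /negP fa0.
have [||n [_ []]] := arch (f a) (f b) => //.
- by rewrite lt_neqAle eq_sym fa0 -f0; have /join_idPl <- := a0; rewrite joinC fU leUl.
- exact: le_n 1%N.
Qed.

End Hyperarchimedean.

(** * Strong units and Boolean supports *)

Section StrongUnit.
Context {R : realType} {V : uHA_obj R}.
Local Notation u := (uha_unit V).
Implicit Types (a x y z : V) (r s t : R) (b c : booleanElt V).

Lemma unit_ge0 : 0 <= u. Proof. by case: (uha_weak_unit V). Qed.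

(** The bound applied to u itself gives u <= r (s u - x)^+. Hence (x - s u)^+, being disjoint from
    (s u - x)^+, is disjoint from the weak unit and vanishes. *)
Lemma vl_bounded_by_unit x : exists r, 0 <= r /\ x <= r *: u.
Proof.
have [r [s [r0 s0 us]]] :=
  hyperarchimedean_bound x (@uha_hyperarchimedean _ V) unit_ge0.
exists s; split=> //; rewrite -vl_subr_ge0 -vl_leN2 oppr0 opprB.
have <- : (x - s *: u) `|` 0 = 0; last exact: leUl.
apply: (proj2 (uha_weak_unit V)).
apply: (vl_disjoint_le unit_ge0 (leUr _ _) us).
apply: vl_disjointZ => //; rewrite ?leUr//.
by rewrite -[x - _]opprB vl_posI_neg.
Qed.

(* s a meets u in the Boolean support of a *)
Lemma boolean_support a : 0 <= a -> exists (s : R) b, 0 < s /\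
  forall r, s <= r -> (r *: a) `&` u = val b.
Proof.
move=> a0; have u0 := unit_ge0.
have [r [s1 [r0 s10 as1]]] := hyperarchimedean_bound u (@uha_hyperarchimedean _ V) a0.
(* [s1] may be 0; a larger factor preserves the bound and is positive. *)
pose s := (s1 + 1)%R.
have s0 : 0 < s by rewrite ltr_wpDl.
have sa0 : 0 <= s *: a by rewrite vl_scale_ge0// ltW.
pose e := (s *: a) `&` u.
have e0 : 0 <= e by rewrite lexI sa0.
have eu : e <= u by exact: leIr.
have ue0 : 0 <= u - e by rewrite vl_subr_ge0.
(* a lies below a multiple of (s a - u)^+, while u - e is the disjoint element (u - s a)^+. *)
have disj : a `&` (u - e) = 0.
  have as_ : a <= r *: ((s *: a - u) `|` 0).
    by rewrite (le_trans as1)// vl_scale_le2l// leU2// vl_leD2r vl_scale_le2r// lerDl.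
  apply: (vl_disjoint_le a0 ue0 as_).
  apply: vl_disjointZ => //; rewrite ?leUr//.
  by rewrite /e [s *: a `&` u]meetC vl_subI -[u - _]opprB vl_posI_neg.
have be : boolean_element e.
  apply/boolean_elementP; split=> //.
  apply: (vl_disjoint_le e0 ue0 (leIl _ _)).
  by apply: vl_disjointZ => //; exact: ltW.
exists s, (mkBool be); split=> // k sk.
have k0 : 0 <= k by rewrite (le_trans _ sk)// ltW.
have ka0 : 0 <= k *: a by rewrite vl_scale_ge0.
apply/le_anti/andP; split; last first.
  by rewrite /= /e leI2// vl_scale_le2r.
(* A factor k >= s gives nothing more: in u = (u - e) + e the first summand is disjoint from k a. *)
rewrite /= meetC -[X in X `&` _](subrK e) (le_trans (vl_meetD_le _ _ _))//.
rewrite meetC vl_disjointZ// add0r.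
exact: leIl.
Qed.

(** Scaling [boolean_support] at 1/r by r: truncated at a low enough level, a is a multiple of its
    Boolean support. *)
Lemma boolean_supportZ a : 0 <= a -> exists (s : R) b, 0 < s /\
  forall r, 0 < r -> r <= s -> a `&` (r *: u) = r *: val b.
Proof.
move=> /boolean_support[s [b [s0 sb]]]; exists s^-1, b; rewrite invr_gt0; split=> // r r0 rs.
rewrite -(sb r^-1); last by rewrite -[s]invrK lef_pV2// posrE invr_gt0.
by rewrite vl_scaleI ?ltW// scalerA divff ?gt_eqF// scale1r.
Qed.

(** If the support b of |x - y| were nonzero, some nonzero c <= b would be disjoint from |x - y|,
    yet c <= b <= s |x - y|. So b is bottom, |x - y| is disjoint from u, and x = y. *)
Lemma polar_ext x y :
  (forall b, b != \bot -> exists c, [/\ c != \bot, c <= b & vl_polar (val c) (x - y)]) ->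
  x = y.
Proof.
move=> dense; apply/eqP; rewrite -subr_eq0; apply/eqP/vl_abs_eq0.
have [s [b [s0 sb]]] := boolean_support (vl_abs_ge0 (x - y)).
have sb' : vl_abs (x - y) `&` u = 0 -> vl_abs (x - y) = 0.
  by move=> ?; apply: (proj2 (uha_weak_unit V)); rewrite meetC.
have sxy0 : 0 <= s *: vl_abs (x - y) by rewrite vl_scale_ge0 ?vl_abs_ge0// ltW.
have b0 : b = \bot.
  apply/eqP; apply: contrapT => /negP b0.
  have [c [c0 cb]] := dense _ b0; rewrite /vl_polar => cxy.
  have vc0 : 0 <= val c by case/boolean_elementP: (booleanEltP c).
  move/eqP: c0; apply; apply: val_inj => /=.
  have <- : (s *: vl_abs (x - y)) `&` val c = 0.
    by apply: vl_disjointZ; rewrite ?vl_abs_ge0// ltW.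
  apply/esym/meet_idPr; apply: le_trans (cb : val c <= val b) _.
  by rewrite -(sb s)// leIl.
apply: sb'; have := sb _ (lexx s); rewrite b0 /= => sxyu.
rewrite -[vl_abs _]scale1r -(@mulVf _ s) ?gt_eqF// -scalerA.
by apply: vl_disjointZ => //; rewrite ?unit_ge0// invr_ge0 ltW.
Qed.

End StrongUnit.

(** * The indicator map from B to the Boolean elements of its Specker group *)

Section Indicator.
Context {R : realType} {d : Order.disp_t} {B : ctbDistrLatticeType d}.
Local Notation H := (specker R B : vectLatticeType R).
Implicit Types (b c : B) (x y : specker R B).

(** Discarding bottom yields a partition even when b is bottom or top. *)
Definition two_blocks b : {fset B} := [fset c in [fset b; (~` b)%O] | c != \bot%O]%fset.

Lemma two_blocksP b c :
  reflect (c != \bot /\ (c = b \/ c = ~` b)) (c \in two_blocks b).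
Proof.
rewrite !inE /=; apply: (iffP andP) => [[/orP[] /eqP -> ?]|[c0 cE]].
- by split=> //; left.
- by split=> //; right.
- by split=> //; apply/orP; case: cE => ->; [left|right].
Qed.

Lemma two_blocks_partition b : is_partition [set` two_blocks b].
Proof.
apply/is_partitionP; split.
  split=> [/two_blocksP[]|c c' /two_blocksP[_ cE] /two_blocksP[_ c'E]].
    by rewrite eqxx.
  by case: cE c'E => -> [] -> // _; rewrite ?meetxC// meetC meetxC.
move=> c c0; have [cb|cb] := eqVneq (c `&` b) \bot.
  have cNb : c `&` ~` b = c by rewrite -[RHS]meetx1 -(joinxC b) meetUr cb join0x.
  exists (~` b); last by rewrite cNb.
  apply/two_blocksP; split; last by right.
  by apply: contraNneq c0 => e; rewrite -cNb e meetx0.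
exists b => //; apply/two_blocksP; split; last by left.
by apply: contraNneq cb => ->; rewrite meetx0.
Qed.

Definition pre_indicator b : preSpecker R B :=
  @mkPre R _ B [fmap c : two_blocks b => (val c == b)%:R] (two_blocks_partition b).

(** The indicator of b is constant on such a c; these c are dense by [decides_dense]. *)
Definition decides c b : bool := (c <= b) || (c <= ~` b).

Lemma decidesS c c' b : c' <= c -> decides c b -> decides c' b.
Proof. by move=> c'c /orP[] /(le_trans c'c) ?; apply/orP; [left|right]. Qed.

Lemma decides_dense (bs : seq B) c : c != \bot ->
  exists c', [/\ c' != \bot, c' <= c & all (decides c') bs].
Proof.
move=> c0; elim: bs => [|b bs [c1 [c10 c1c c1bs]]]; first by exists c.
have [b' b'P c1b'] := proj2 (proj1 (is_partitionP _) (two_blocks_partition b)) _ c10.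
exists (c1 `&` b'); split=> //; first by rewrite (le_trans (leIl _ _)).
rewrite /=; apply/andP; split.
  by move/two_blocksP: b'P => [_ [->|->]]; rewrite /decides leIr ?orbT.
by apply: sub_all c1bs => b''; apply: decidesS; exact: leIl.
Qed.

Lemma pdef_indicator b c : c != \bot -> decides c b -> pdef (pre_indicator b) c.
Proof.
move=> c0 cb; apply/existsP.
have [b' b'P cb'] : exists2 b', b' \in two_blocks b & c <= b'.
  case/orP: cb => cb; [exists b => //|exists (~` b) => //]; apply/two_blocksP.
    by split; [apply: contraNneq c0 => b0; rewrite -lex0 -b0|left].
  by split; [apply: contraNneq c0 => b0; rewrite -lex0 -b0|right].
by exists [` b'P]%fset.
Qed.

Lemma pval_indicator b c : c != \bot -> decides c b ->
  pval (pre_indicator b) c = (c <= b)%O%:R.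
Proof.
move=> c0 cb; have [b' [cb' ->]] := pdefP c0 (pdef_indicator c0 cb).
rewrite /pfun ffunE; have /two_blocksP[b'0 [b'E|b'E]] : val b' \in two_blocks b by exact: fsvalP.
  by rewrite b'E eqxx -b'E cb'.
rewrite b'E in b'0 cb' *.
(* An element equal to its own complement is bottom, which is not a block. *)
have -> : (~` b == b) = false.
  apply: contraNF b'0 => /eqP bb; apply/eqP.
  by rewrite -[LHS]meetxx {1}bb meetxC.
have -> // : (c <= b) = false.
apply: contraNF c0 => cb''; rewrite -lex0 -(meetxC b) lexI cb''.
exact: cb'.
Qed.

Definition indicator b : specker R B := \pi_(specker R B) (pre_indicator b).

Lemma sval_indicator b c : c != \bot -> decides c b -> sdef_at (indicator b) c ->
  sval_at (indicator b) c = (c <= b)%O%:R.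
Proof. by move=> c0 cb cd; rewrite sval_pi ?pval_indicator// pdef_indicator. Qed.

Lemma specker_ext_decides (s : seq (specker R B)) (bs : seq B) x y :
  (forall c, c != \bot -> sdef_at x c -> sdef_at y c -> all (decides c) bs ->
    all (sdef_at^~ c) s -> sval_at x c = sval_at y c) -> x = y.
Proof.
move=> xy; apply: (@specker_ext _ _ _ s) => c c0 cx cy cs.
have [c' [c'0 c'c c'bs]] := decides_dense bs c0.
rewrite -(svalS c'0 c'c cx) -(svalS c'0 c'c cy); apply: xy => //.
- exact: sdefS cx.
- exact: sdefS cy.
- by apply: sub_all cs => z; exact: sdefS.
Qed.

Lemma decides_notle c b : c != \bot -> decides c b -> (c <= ~` b) = ~~ (c <= b).
Proof.
move=> c0 /orP[cb|cb]; rewrite cb.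
  by apply: contraNF c0 => cNb; rewrite -lex0 -(meetxC b) lexI cb.
by apply/esym; apply: contraNN c0 => cb'; rewrite -lex0 -(meetxC b) lexI cb'.
Qed.

Lemma indicatorI b b' : indicator (b `&` b') = (indicator b : H) `&` indicator b'.
Proof.
apply: (@specker_ext_decides [:: indicator b; indicator b'] [:: b; b'; b `&` b']).
move=> c c0 cx cy /= /and4P[cb cb' cbb' _] /and3P[d1 d2 _].
rewrite svalI// !sval_indicator// lexI.
by rewrite /Order.min ltr_nat; case: (c <= b); case: (c <= b').
Qed.

Lemma indicatorC b : indicator (~` b) = specker_unit R B - indicator b.
Proof.
apply: (@specker_ext_decides
  [:: indicator b; specker_unit R B; - indicator b] [:: b; ~` b]).
move=> c c0 cx cy /= /and3P[cb cNb _] /and4P[d1 d2 d3 _].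
rewrite svalD// sval1// -scaleN1r svalZ// ?scaleN1r// !sval_indicator//.
rewrite decides_notle//.
by case: (c <= b) => /=; rewrite ?mulr0 ?mulr1 ?subrr ?addr0.
Qed.

Lemma indicator0 : indicator \bot = 0.
Proof.
apply: (@specker_ext_decides [::] [:: \bot]).
move=> c c0 cx cy /= /andP[cb _] _.
by rewrite sval_indicator// sval0// lex0 (negPf c0).
Qed.

Lemma indicator1 : indicator \top = specker_unit R B.
Proof.
apply: (@specker_ext_decides [::] [:: \top]).
move=> c c0 cx cy /= /andP[cb _] _.
by rewrite sval_indicator// sval1// lex1.
Qed.

Lemma indicatorU b b' : indicator (b `|` b') = (indicator b : H) `|` indicator b'.
Proof.
rewrite -[b `|` b']complK complU indicatorC indicatorI !indicatorC.
by rewrite -vl_addI -vl_oppU opprD opprK addrA subrr add0r.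
Qed.

Lemma indicator_boolean b : @boolean_element R (specker_uHA R B) (indicator b).
Proof.
by exists (indicator (~` b)); rewrite -indicatorI -indicatorU meetxC joinxC indicator0 indicator1.
Qed.

(** If b is not below b', then on a small nonzero block under b and the complement of b' the two
    indicators take the values 1 and 0. *)
Lemma indicator_inj : injective indicator.
Proof.
have le b b' : indicator b = indicator b' -> b <= b'.
  move=> bb'; have [/eqP|c0] := eqVneq (b `&` ~` b') \bot; first by rewrite disj_leC complK.
  have [c [c0' cb cs]] := sdef_dense [:: indicator b; indicator b'] c0.
  move: cs => /= /and3P[d1 d2 _].
  have [/= c1 c2] : c <= b /\ c <= ~` b' by apply/andP; rewrite -lexI.
  have := sval_indicator c0' (_ : decides c b) d1.
  rewrite bb' sval_indicator// /decides ?c1 ?c2 ?orbT// => /(_ isT) /eqP.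
  have := decides_notle c0' (_ : decides c b'); rewrite /decides c2 orbT => /(_ isT).
  by case: (c <= b') => // _; rewrite eq_sym oner_eq0.
by move=> b b' bb'; apply/le_anti; rewrite !le.
Qed.

(** The inverse of [indicator] on Boolean elements. *)
Definition one_level x : B := \join_(b : pdom (repr x) | pfun b == 1) val b.

Lemma boolean_indicator x : @boolean_element R (specker_uHA R B) x ->
  x = indicator (one_level x).
Proof.
move=> /boolean_elementP[_ _ xI].
(* Locally, x [&] (u - x) = 0 reads min(t, 1 - t) = 0 for the value t of x, so t is 0 or 1. *)
have x01 c : c != \bot -> sdef_at x c -> sval_at x c = 0 \/ sval_at x c = 1.
  move=> c0 cx; have [c' [c'0 c'c /= /and5P[h1 h2 h3 h4 _]]] :=
    sdef_dense [:: (x : H) `&` (specker_unit R B - x); specker_unit R B - x;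
      specker_unit R B; - x] c0.
  have c'x := sdefS c'c cx.
  have := svalI c'0 c'x h2 h1; rewrite svalD// sval1// -scaleN1r svalZ// ?scaleN1r//.
  rewrite -(svalS c'0 c'c cx) mulN1r.
  have -> : sval_at ((x : H) `&` (specker_unit R B - x)) c' = 0.
    by move: h1; rewrite [(x : H) `&` _]xI => h1; rewrite sval0.
  by case: ltP => _ /eqP; rewrite eq_sym ?subr_eq0 => /eqP ->; [left|right].
apply: (@specker_ext_decides [:: x] [:: one_level x]).
move=> c c0 cx cy /= /andP[cb _] _.
rewrite sval_indicator//.
have [b [cb' xb]] := pdefP c0 cx.
have [x0|x1] := x01 _ c0 cx; last first.
  rewrite x1; suff -> : c <= one_level x by [].
  rewrite /sval_at xb in x1.
  by apply: (le_trans cb'); apply: joins_sup; exact/eqP.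
rewrite x0; suff -> : (c <= one_level x) = false by [].
(* x is 0 on the block b, so every block of value 1 differs from b and is disjoint from it. *)
suff le1b : one_level x <= ~` val b.
  apply: contraNF c0 => c1; rewrite -lex0 -(meetxC (val b)) lexI cb'.
  exact: le_trans le1b.
apply/joinsP => b' b'1; rewrite -disj_leC; apply/eqP.
have [[_ vd] _] := pdomP (repr x); apply: vd; [exact: fsvalP|exact: fsvalP|].
move=> /val_inj bb'; move: x0; rewrite /sval_at xb -bb' (eqP b'1) => /eqP.
by rewrite oner_eq0.
Qed.

Definition indicator_hom : boolHom B (booleanElt (specker_uHA R B)).
Proof.
apply: (@BoolHom _ _ _ _ (fun b => mkBool (indicator_boolean b))).
- by move=> b b'; apply: val_inj; exact: indicatorI.
- by move=> b b'; apply: val_inj; exact: indicatorU.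
- by apply: val_inj; exact: indicator0.
- by apply: val_inj; exact: indicator1.
Defined.

End Indicator.

(** Naturality of the indicator map. On a block below f b, or below its complement, both sides are
    read off at b, or at the complement of b. *)
Lemma specker_map_indicator (R : realType) d d' (B : ctbDistrLatticeType d)
    (A : ctbDistrLatticeType d') (f : boolHom B A) b :
  specker_map f (@indicator R d B b) = indicator (f b).
Proof.
rewrite /indicator specker_map_pi; apply/eqmodP/pre_eqP => a a0 am ai.
have [a' [a'0 a'a /= /andP[a'b _]]] := decides_dense [:: f b] a0.
rewrite -(pvalS a'0 a'a am) -(pvalS a'0 a'a ai) pval_indicator//.
have afc c : a' <= f c -> c != \bot.
  by move=> a'c; apply: contraNneq a'0 => e; rewrite -lex0 -(bool_bot f) -e.
case/orP: (a'b) => ab.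
  rewrite (pval_map a'0 ab) ?pval_indicator ?pdef_indicator ?(afc b)// /decides lexx//.
  by rewrite ab.
rewrite -bool_compl in ab.
rewrite (pval_map a'0 ab) ?pval_indicator ?pdef_indicator ?(afc _ ab)// /decides ?lexx ?orbT//.
have := decides_notle a'0 a'b; rewrite -bool_compl ab.
have := decides_notle (afc _ ab) (_ : decides (~` b) b).
by rewrite /decides lexx orbT => /(_ isT); case: (_ <= _) => //; case: (_ <= _).
Qed.

(** * The evaluation map from the Specker group of the Boolean elements to V *)

Section Evaluation.
Context {R : realType} (V : uHA_obj R).
Local Notation u := (uha_unit V).
Local Notation BV := (booleanElt V).
Local Notation H := (specker R BV : vectLatticeType R).
Implicit Types (z t : V) (r s : R) (b c : BV) (x y : specker R BV)
  (v : preSpecker R BV).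

Lemma booleanElt_ge0 c : 0 <= val c.
Proof. by case/boolean_elementP: (booleanEltP c). Qed.

Lemma booleanElt_le_unit c : val c <= u.
Proof. by case/boolean_elementP: (booleanEltP c). Qed.

Lemma unit_scaleI r s : (r *: u) `&` (s *: u) = Num.min r s *: u.
Proof.
have aux r' s' : r' <= s' -> (r' *: u) `&` (s' *: u) = r' *: u.
  by move=> rs; apply/meet_idPl/vl_scale_le2r => //; exact: unit_ge0.
by case: leP => [/aux//|/ltW/aux]; rewrite meetC.
Qed.

Lemma unit_scaleU r s : (r *: u) `|` (s *: u) = Num.max r s *: u.
Proof.
have aux r' s' : r' <= s' -> (r' *: u) `|` (s' *: u) = s' *: u.
  by move=> rs; apply/join_idPr/vl_scale_le2r => //; exact: unit_ge0.
by case: leP => [/aux//|/ltW/aux]; rewrite joinC.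
Qed.

(** If r and s differ, dividing by |r - s| makes u disjoint from c; but c <= u, so c is bottom. *)
Lemma polar_unit_inj c r s : c != \bot -> vl_polar (val c) (r *: u - s *: u) ->
  r = s.
Proof.
move=> c0; rewrite -scalerBl /vl_polar vl_absZ (vl_ge0_abs unit_ge0) => rsc.
apply/eqP; rewrite -subr_eq0 -normr_eq0; apply: contraNT c0 => rs0.
have u0 := @unit_ge0 _ V; apply/eqP/val_inj => /=.
rewrite -[LHS](meet_idPr (booleanElt_le_unit c)) -[u]scale1r -(mulVf rs0) -scalerA.
by apply: vl_disjointZ; rewrite ?invr_ge0// ?vl_scale_ge0 ?booleanElt_ge0.
Qed.

Definition pre_eval (v : preSpecker R BV) : V :=
  \sum_(b : pdom v) pfun b *: val (val b).

(** The summand at b differs from v(b) u by a multiple of u - b, which is disjoint from b; every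
    other summand is a multiple of a block disjoint from b. *)
Lemma pre_eval_polar v (b : pdom v) :
  vl_polar (val (val b)) (pre_eval v - pfun b *: u).
Proof.
have Ib := vl_ideal_polar (booleanElt_ge0 (val b)).
rewrite /pre_eval (bigD1 b)//= addrAC -scalerBr; apply: (idealD Ib).
  apply: (idealZ Ib); rewrite /vl_polar vl_absB vl_ge0_abs.
    by rewrite meetC; case/boolean_elementE: (booleanEltP (val b)).
  by rewrite vl_subr_ge0 booleanElt_le_unit.
apply: big_ind => [|z t zI tI|b' b'b]; [exact: ideal0|exact: idealD|].
apply: (idealZ Ib); rewrite /vl_polar vl_ge0_abs ?booleanElt_ge0//.
rewrite -belt_meetE; have [[_ vd] _] := pdomP v.
rewrite vd//; [exact: fsvalP|exact: fsvalP|].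
by move=> /val_inj bb'; rewrite bb' eqxx in b'b.
Qed.

(** The sum over the chosen representative; later proofs see it only through [eval_polar]. *)
Definition eval x : V := pre_eval (repr x).

Lemma eval_polar x c : c != \bot -> sdef_at x c ->
  vl_polar (val c) (eval x - sval_at x c *: u).
Proof.
move=> c0 cx; have [b [cb xb]] := pdefP c0 cx.
rewrite /sval_at xb; apply: vl_polarS (pre_eval_polar b); first exact: booleanElt_ge0.
exact: cb.
Qed.

Lemma eval_ext (s : seq (specker R BV)) z t :
  (forall c, c != \bot -> all (sdef_at^~ c) s -> vl_polar (val c) (z - t)) ->
  z = t.
Proof.
move=> zt; apply: polar_ext => b b0.
by have [c [c0 cb cs]] := sdef_dense s b0; exists c; split=> //; exact: zt.
Qed.

(** On a block where all the elements involved are constant, both sides are congruent, modulo its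
    polar, to the same multiple of u. *)
Lemma eval_linear_lattice : linear_lattice_hom (eval : H -> V).
Proof.
split=> [r x y|x y|x y].
- apply: (@eval_ext [:: x; y; r *: x; r *: x + y]).
  move=> c c0 /= /and5P[cx cy crx crxy _].
  have Ic := vl_ideal_polar (booleanElt_ge0 c).
  apply: (ideal_trans Ic (eval_polar c0 crxy)).
  rewrite svalD// svalZ// scalerDl -scalerA; apply: (ideal_subr Ic).
  by apply: (ideal_congrD Ic); [apply: (ideal_congrZ Ic)|]; exact: eval_polar.
- apply: (@eval_ext [:: x; y; (x : H) `&` y]) => c c0 /= /and4P[cx cy cxy _].
  have Ic := vl_ideal_polar (booleanElt_ge0 c).
  apply: (ideal_trans Ic (eval_polar c0 cxy)).
  rewrite svalI// -unit_scaleI; apply: (ideal_subr Ic).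
  by apply: (ideal_congrI Ic); exact: eval_polar.
- apply: (@eval_ext [:: x; y; (x : H) `|` y]) => c c0 /= /and4P[cx cy cxy _].
  have Ic := vl_ideal_polar (booleanElt_ge0 c).
  apply: (ideal_trans Ic (eval_polar c0 cxy)).
  rewrite svalU// -unit_scaleU; apply: (ideal_subr Ic).
  by apply: (ideal_congrU Ic); exact: eval_polar.
Qed.

Lemma eval_unit : eval (specker_unit R BV) = u.
Proof.
apply: (@eval_ext [:: specker_unit R BV]) => c c0 /= /andP[c1 _].
by have := eval_polar c0 c1; rewrite sval1// scale1r.
Qed.

(** Both sides agree with u on blocks below b, and with 0 on blocks below its complement. *)
Lemma eval_indicator b : eval (indicator b) = val b.
Proof.
apply: polar_ext => c1 c10.
have [c2 [c20 c21 /= /andP[c2d _]]] := sdef_dense [:: @indicator R _ _ b] c10.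
have [c [c0 cc2 /= /andP[cb _]]] := decides_dense [:: b] c20.
exists c; split=> //; first exact: le_trans c21.
have Ic := vl_ideal_polar (booleanElt_ge0 c).
have cd := sdefS cc2 c2d.
apply: (ideal_trans Ic (eval_polar c0 cd)); rewrite sval_indicator//.
have := decides_notle c0 cb; case: (boolP (c <= b)) => [cb' _|_ cb'].
  rewrite scale1r; apply: (vl_polarS (booleanElt_ge0 c) (cb' : val c <= val b)).
  rewrite /vl_polar vl_ge0_abs ?vl_subr_ge0 ?booleanElt_le_unit// meetC.
  by case/boolean_elementE: (booleanEltP b).
rewrite scale0r sub0r; apply: (idealN Ic).
apply: (vl_polarS (booleanElt_ge0 c) (cb' : val c <= u - val b)).
rewrite /vl_polar vl_ge0_abs ?booleanElt_ge0//.
by case/boolean_elementE: (booleanEltP b).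
Qed.

Lemma eval_inj : injective eval.
Proof.
move=> x y xy; apply: (@specker_ext _ _ _ [::]) => c c0 cx cy _.
have Ic := vl_ideal_polar (booleanElt_ge0 c).
apply: (polar_unit_inj c0); apply: (ideal_trans Ic) (eval_polar c0 cy).
by rewrite -xy; apply: (ideal_subr Ic); exact: eval_polar.
Qed.

Lemma eval0 : eval 0 = 0.
Proof.
have [fl _ _] := eval_linear_lattice.
by have := fl (- 1) 0 0; rewrite scaler0 addr0 scaleN1r addNr.
Qed.

Lemma evalD x y : eval (x + y) = eval x + eval y.
Proof.
by have [fl _ _] := eval_linear_lattice; have := fl 1 x y; rewrite !scale1r.
Qed.

Lemma evalZ r x : eval (r *: x) = r *: eval x.
Proof.
have [fl _ _] := eval_linear_lattice.
by have := fl r x 0; rewrite eval0 !addr0.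
Qed.

(** The increment of the truncation from r to s is (z - r u)^+ [&] (s - r) u, which
    [boolean_supportZ] computes. *)
Lemma truncation_right z r : exists (e : R) b, 0 < e /\
  forall s, r < s -> s <= r + e -> z `&` (s *: u) = z `&` (r *: u) + (s - r) *: val b.
Proof.
have [e [b [e0 eb]]] := boolean_supportZ (leUr (0 : V) (z - r *: u : V)).
exists e, b; split=> // s rs sre.
rewrite -eb ?subr_gt0//; last by rewrite lerBlDl.
rewrite -vl_subI vl_addI subrKC [X in _ = _ `&` X]addrC vl_addI -scalerDl subrK.
rewrite meetA [z `&` (_ + z)]meet_l// -[leLHS]add0r vl_leD2r.
by rewrite vl_scale_ge0 ?unit_ge0// subr_ge0 ltW.
Qed.

Lemma truncation_left z r : exists (e : R) b, 0 < e /\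
  forall s, s < r -> r - e <= s -> z `&` (r *: u) = z `&` (s *: u) + (r - s) *: val b.
Proof.
have [e [b [e0 eb]]] := boolean_supportZ (leUr (0 : V) (r *: u - z : V)).
(* b supports (r u - z)^+. Just below r the truncation grows only where z reaches r u, that is, off
   b; hence the complement. *)
exists e, (~` b); split=> // s rs sre.
rewrite belt_complE scalerBr -eb ?subr_gt0//; last by rewrite lerBlDl -lerBlDr.
have sru : s *: u <= r *: u by rewrite vl_scale_le2r ?unit_ge0// ltW.
rewrite -vl_subI scalerBl [r *: u `&` z]meetC.
have -> : z `&` (s *: u) = (z `&` (r *: u)) `&` (s *: u) by rewrite -meetA (meet_r sru).
(* The increment turns out to be (y [|] w) - w, so the claim is the identity for the sum of a meet
   and a join. *)
set y := z `&` (r *: u); set w := s *: u.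
have -> : (r *: u - y) `&` (r *: u - w) = r *: u - (y `|` w).
  by rewrite vl_oppU vl_addI.
by rewrite opprB [X in _ + X]addrC subrKA addrA vl_meetDjoin addrK.
Qed.

Lemma truncation_in_range z r : 0 <= z -> 0 <= r ->
  exists x, eval x = z `&` (r *: u).
Proof.
move=> z0 r0.
have step (s t : V) b (q : R) : (exists x, eval x = s) -> t = s + q *: val b ->
    exists x, eval x = t.
  move=> [x <-] ->; exists (x + q *: indicator b).
  by rewrite evalD evalZ eval_indicator.
pose T (s : R) := (0 <= s <= r)%R /\ exists x, eval x = z `&` (s *: u).
have T0 : T 0.
  by split; [rewrite lexx|exists 0; rewrite eval0 scale0r; apply/esym/meet_r].
have Tr : ubound T r by move=> s [/andP[]].
have supT : has_sup T by split; [exists 0|exists r].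
pose m := sup T.
have m0 : 0 <= m by exact: (ub_le_sup (proj2 supT) T0).
have mr : m <= r by exact: (ge_sup (proj1 supT) Tr).
have Tm : T m.
  (* Some s in T lies within e of the supremum m, and one Boolean step leads from s to m. *)
  have [e [b [e0 eb]]] := truncation_left z m.
  have [s Ts ms] := sup_adherent e0 supT.
  have := ub_le_sup (proj2 supT) Ts; rewrite -/m le_eqVlt => /predU1P[<-//|sm].
  split; first by rewrite m0.
  by apply: step (proj2 Ts) (eb _ sm (ltW ms)).
have [rm|rm] := ltP m r; last first.
  have <- : m = r by apply/le_anti; rewrite mr.
  exact: (proj2 Tm).
have [e [b [e0 eb]]] := truncation_right z m.
(* One step to the right of m, cut off at r to remain in the interval, contradicts that m is the
   supremum. *)
pose s := Num.min r (m + e).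
have ms : m < s by rewrite lt_min rm ltrDl.
have : T s.
  split; first by rewrite ge_min lexx (le_trans m0)// ltW.
  apply: step (proj2 Tm) (eb _ ms _).
  by rewrite ge_min lexx orbT.
by move=> /(ub_le_sup (proj2 supT)); rewrite leNgt ms.
Qed.

(** As u is a strong unit, a positive element is its own truncation at a high level; in general z is
    the difference of its positive and negative parts. *)
Lemma eval_surj z : exists x, eval x = z.
Proof.
have pos t : 0 <= t -> exists x, eval x = t.
  move=> t0; have [r [r0 tr]] := vl_bounded_by_unit t.
  by have := truncation_in_range t0 r0; rewrite (meet_l tr).
rewrite -(vl_posBneg z).
have [x <-] := pos _ (leUr (0 : V) (z : V)).
have [y <-] := pos _ (leUr (0 : V) (- z : V)).
by exists (x - y); rewrite evalD -scaleN1r evalZ scaleN1r.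
Qed.

Definition eval_hom : uHA_hom (specker_uHA R BV) V :=
  @UHAHom R (specker_uHA R BV) V eval eval_linear_lattice eval_unit.

End Evaluation.

(** Let x have value r on c, and let a <= g(c). Applying g to |eval x - r u| [&] c = 0 shows that
    the right-hand side is r u on a, as is the left-hand side. *)
Lemma eval_natural (R : realType) (V W : uHA_obj R) (g : uHA_hom V W)
    (x : specker R (booleanElt V)) :
  eval (specker_map (Bfun_hom g) x) = g (eval x).
Proof.
have [gl gI gU] := uha_linear_lattice_hom g.
have gZ r z : g (r *: z) = r *: g z.
  by have := gl r z 0; rewrite uHA_hom0 !addr0.
have gN z : g (- z) = - g z by rewrite -scaleN1r gZ scaleN1r.
apply: polar_ext => b b0.
have [b1 [b10 b1b /= /andP[b1x _]]] := sdef_dense [:: specker_map (Bfun_hom g) x] b0.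
have [a [c [a0 ab1 ac /= /andP[cx _]]]] := sdef_dense_map (Bfun_hom g) [:: x] b10.
exists a; split=> //; first exact: le_trans b1b.
have Ia := vl_ideal_polar (booleanElt_ge0 a).
have ax := sdefS ab1 b1x.
have c0 : c != \bot.
  by apply: contraNneq a0 => e; rewrite -lex0 -(bool_bot (Bfun_hom g)) -e.
apply: (ideal_trans Ia (eval_polar a0 ax)); rewrite (sval_map a0 ac)//.
apply: (ideal_subr Ia).
apply: (vl_polarS (booleanElt_ge0 a) (ac : val a <= g (val c))).
have := congr1 g (eval_polar c0 cx); rewrite uHA_hom0 gI gU gN.
have -> // : g (eval x - sval_at x c *: uha_unit V) =
    g (eval x) - sval_at x c *: uha_unit W.
by rewrite addrC -scaleNr gl uha_fun_unit scaleNr addrC.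
Qed.

(** * Isomorphisms from bijections, and the equivalence *)

Lemma naturally_isomorphic_sym (C D : category) (F G : functor C D) :
  naturally_isomorphic F G -> naturally_isomorphic G F.
Proof.
move=> [alpha [nat iso]].
pose beta X := sval (cid (iso X)).
have [betaK alphaK] : (forall X, compm (beta X) (alpha X) = idm (F X)) /\
    (forall X, compm (alpha X) (beta X) = idm (G X)).
  by split=> X; have [] := svalP (cid (iso X)).
exists beta; split=> [X Y f|X]; last by exists (alpha X).
rewrite -[fhom G f]compm1 -alphaK [X in compm (beta Y) X]compmA -nat.
by rewrite !compmA betaK comp1m.
Qed.

Lemma bijective_boolHom_iso (A B : BA) (f : hom A B) :
  injective (bool_fun f) -> (forall b, exists a, bool_fun f a = b) -> isomorphism f.
Proof.
move=> finj fsurj; have [g gK] := choice fsurj.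
have fK a : g (bool_fun f a) = a by apply: finj; rewrite gK.
unshelve eexists.
  apply: (@BoolHom _ _ _ _ g).
  - by move=> a b; apply: finj; rewrite bool_meet !gK.
  - by move=> a b; apply: finj; rewrite bool_join !gK.
  - by apply: finj; rewrite bool_bot gK.
  - by apply: finj; rewrite bool_top gK.
by split; apply: boolHom_eq => a; rewrite /= ?gK ?fK.
Qed.

Lemma bijective_uHA_iso (R : realType) (V W : uHA R) (f : hom V W) :
  injective (uha_fun f) -> (forall w, exists v, uha_fun f v = w) -> isomorphism f.
Proof.
move=> finj fsurj; have [g gK] := choice fsurj.
have [fl fI fU] := uha_linear_lattice_hom f.
unshelve eexists.
  apply: (@UHAHom R _ _ g).
  - by split=> [r x y|x y|x y]; apply: finj; rewrite ?fl ?fI ?fU !gK.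
  - by apply: finj; rewrite uha_fun_unit gK.
by split; apply: uHA_hom_eq => a /=; rewrite ?gK//; apply: finj; rewrite gK.
Qed.

Theorem mainTheorem1 (R : realType) :
  naturally_isomorphic (compF (Bfun R) (Hfun R)) (idF BA) /\
  naturally_isomorphic (compF (Hfun R) (Bfun R)) (idF (uHA R)).
Proof.
split.
  (* The indicator map runs from the identity to the composite, opposite to the stated direction. *)
  apply: naturally_isomorphic_sym.
  exists (fun B : BA => @indicator_hom R _ B); split=> [B A f|B].
    by apply: boolHom_eq => b; apply: val_inj; rewrite /= specker_map_indicator.
  apply: bijective_boolHom_iso => [b b' /(congr1 val)|v]; first exact: indicator_inj.
  exists (one_level (val v)); apply: val_inj => /=.
  by rewrite -boolean_indicator//; exact: booleanEltP.
exists (fun V : uHA R => eval_hom V); split=> [V W g|V].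
  by apply: uHA_hom_eq => x; exact: eval_natural.
by apply: bijective_uHA_iso; [exact: eval_inj|exact: eval_surj].
Qed.
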